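(* Let $-\infty<\alpha<\beta\le\alpha+2\pi$, let $\nu$ be a charge on $\mathbb{C}$ of finite type at order $p\in\mathbb{R}^+$ near $\infty$, let $q=\bigl[\frac{\beta-\alpha}\pi p\bigr]$, and suppose $D(r_0)\cap\operatorname{supp}\nu=\varnothing$ for some $r_0>0$. 1. The balayage $\nu^{\mathrm{bal}[q]}_{\mathbb{C}\setminus\angle(\alpha,\beta)}$ of genus $q$ from $\angle(\alpha,\beta)$ exists, and there is a constant $C$ (depending on $\nu,p,\alpha,\beta$) such that for all $r\ge0$ $$\bigl|\nu^{\mathrm{bal}[q]}_{\mathbb{C}\setminus\angle(\alpha,\beta)}\bigr|^{\rm rad}(r)\le C\Bigl(r^p+r^{\frac{\pi q}{\beta-\alpha}}\Bigl|\int_{(D(r)\setminus D(r_0))\cap\angle(\alpha,\beta)}\operatorname{Im}\frac1{(ze^{-i\alpha})^{\frac{\pi q}{\beta-\alpha}}}d\nu(z)\Bigr|\Bigr).$$ 2. For every $p$, $|\nu^{\mathrm{bal}[q]}_{\mathbb{C}\setminus\angle(\alpha,\beta)}|^{\rm rad}(r)=O(r^p\log r)$ as $r\to+\infty$. 3. If $\frac{\beta-\alpha}\pi p\notin\mathbb{N}_0$, then $\nu^{\mathrm{bal}[q]}_{\mathbb{C}\setminus\angle(\alpha,\beta)}$ is of finite type at order $p$. 4. If $q=\frac{\beta-\alpha}\pi p\in\mathbb{N}_0$ and $\bigl|\int_{(D(r)\setminus D(r_0))\cap\angle(\alpha,\beta)}\operatorname{Im}\frac1{(ze^{-i\alpha})^p}d\nu(z)\bigr|=O(1)$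 as $r\to+\infty$ (Blaschke condition of genus $p$), then $\nu^{\mathrm{bal}[q]}_{\mathbb{C}\setminus\angle(\alpha,\beta)}$ is of finite type at order $p$.
   Context: A charge is a real Borel signed measure on $\mathbb{C}$ finite on bounded sets; $|\nu|^{\rm rad}(r)=|\nu|(\{|z|\le r\})$; finite type at order $p$ means $\limsup_{r\to\infty}|\nu|^{\rm rad}(r)/r^p<\infty$. $\angle(\alpha,\beta)=\{re^{i\theta}:r>0,\theta\in(\alpha,\beta)\}$; for $z=re^{i\theta}$ in it and $s>0$, $(ze^{-i\alpha})^s=r^se^{is(\theta-\alpha)}$. Put $\tilde z=(ze^{-i\alpha})^{\pi/(\beta-\alpha)}\in\{\operatorname{Im}w>0\}$. For bounded Borel $B$, $\tilde B=\{t\ge0:t^{(\beta-\alpha)/\pi}e^{i\alpha}\in B\}\cup\{t\le0:|t|^{(\beta-\alpha)/\pi}e^{i\beta}\in B\}\subset\mathbb{R}$ (the two sides treated as distinct even if $\beta=\alpha+2\pi$). Harmonic charge of genus $q$: $\Omega^{[q]}_{\angle(\alpha,\beta)}(z,B)=\frac1\pi\int_{\tilde B}\operatorname{Im}\frac1{t-\tilde z}dt+\frac1\pi\sum_{k=1}^q\operatorname{Im}(\tilde z^{-k})\int_{\tilde B}t^{k-1}dt$. Balayage of genus $q$ from the angle: $\nu^{\mathrm{bal}[q]}_{\mathbb{C}\setminus\angle(\alpha,\beta)}(B)=\int_{\angle(\alpha,\beta)}\Omega^{[q]}_{\angle(\alpha,\beta)}(z,B)d\nu(z)+\nu(B\setminus\angle(\alpha,\beta))$.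 *)

(* Defs.v *)
From HB Require Import structures.
From mathcomp Require Import all_boot all_order all_algebra.
From mathcomp Require Import all_classical all_reals all_analysis.
From mathcomp Require Import complex.
Set Implicit Arguments. Unset Strict Implicit. Unset Printing Implicit Defensive.
Import Order.TTheory GRing.Theory Num.Theory.
Import numFieldNormedType.Exports.
Local Open Scope classical_set_scope.
Local Open Scope ring_scope.

Section Defs.
Variable R : realType.

(* The plane C is modelled by R * R (with its product = Borel sigma-algebra). *)
Definition pt := (R * R)%type.

Definition toCx (z : pt) : R[i] := (z.1 +i* z.2)%C.
Definition modz (z : pt) : R := Num.sqrt (z.1 ^+ 2 + z.2 ^+ 2).

Definition polar (r th : R) : pt := (r * cos th, r * sin th).

Definition odisc (r : R) : set pt := [set z | modz z < r].
Definition cdisc (r : R) : set pt := [set z | modz z <= r].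
Definition oball (z0 : pt) (e : R) : set pt :=
  [set z | modz (z.1 - z0.1, z.2 - z0.2) < e].

Definition bounded_borel (B : set pt) : Prop :=
  measurable B /\ exists r : R, B `<=` cdisc r.

Definition tvar (m : set pt -> R) (A : set pt) : \bar R :=
  ereal_sup [set x | exists (n : nat) (F : nat -> set pt),
    (forall i, (i < n)%N -> measurable (F i) /\ F i `<=` A) /\
    trivIset [set i | (i < n)%N] F /\
    x = ((\sum_(i < n) `|m (F i)|)%R)%:E].

Definition tvrad (m : set pt -> R) (r : R) : \bar R := tvar m (cdisc r).

(* finite type at order p near infinity:
   limsup_{r -> +oo} |m|^rad(r) / r^p < +oo *)
Definition finite_type (m : set pt -> R) (p : R) : Prop :=
  exists (C r1 : R), forall r, r1 <= r -> (tvrad m r <= (C * r `^ p)%:E)%E.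

Definition csupport (m : set pt -> R) : set pt :=
  [set z | forall e : R, 0 < e -> tvar m (oball z e) <> 0%E].

(* A charge nu on C, given by its Jordan decomposition nu = mup - mun:
   two positive Borel measures, finite on bounded sets, mutually singular. *)
Definition jordan (mup mun : {measure set pt -> \bar R}) : Prop :=
  (forall r : R, (mup (cdisc r) < +oo)%E /\ (mun (cdisc r) < +oo)%E) /\
  exists P : set pt, measurable P /\ mup (~` P) = 0%E /\ mun P = 0%E.

(* the set function of the charge (meaningful on bounded Borel sets) *)
Definition chg (mup mun : {measure set pt -> \bar R}) (B : set pt) : R :=
  fine (mup B) - fine (mun B).

Definition nu_integrable (mup mun : {measure set pt -> \bar R})
  (D : set pt) (f : pt -> R) : Prop :=
  mup.-integrable D (EFin \o f) /\ mun.-integrable D (EFin \o f).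

Definition nu_int (mup mun : {measure set pt -> \bar R})
  (D : set pt) (f : pt -> R) : R :=
  Rintegral mup D f - Rintegral mun D f.

Definition angle (a b : R) : set pt :=
  [set z | exists r th, 0 < r /\ a < th < b /\ z = polar r th].

Definition arg_in (a b : R) (z : pt) : R :=
  xget 0 [set th | a < th < b /\ z = polar (modz z) th].

(* (z e^{-ia})^s = r^s e^{is(theta - a)} for z = r e^{i theta} in angle(a,b) *)
Definition rotpow (a b s : R) (z : pt) : R[i] :=
  let r := modz z in let th := arg_in a b z in
  ((r `^ s * cos (s * (th - a))) +i* (r `^ s * sin (s * (th - a))))%C.

Definition ztilde (a b : R) (z : pt) : R[i] := rotpow a b (pi / (b - a)) z.

Definition Btilde (a b : R) (B : set pt) : set R :=
  [set t | (0 <= t /\ B (polar (t `^ ((b - a) / pi)) a)) \/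
           (t <= 0 /\ B (polar (`|t| `^ ((b - a) / pi)) b))].

Definition Omega (a b : R) (q : nat) (z : pt) (B : set pt) : R :=
  pi^-1 * Rintegral lebesgue_measure (Btilde a b B)
            (fun t : R => complex.Im ((t%:C - ztilde a b z)^-1)%C)
  + pi^-1 * \sum_(1 <= k < q.+1)
      complex.Im ((ztilde a b z) ^- k)%C *
      Rintegral lebesgue_measure (Btilde a b B) (fun t : R => t ^+ k.-1).

Definition balayage (a b : R) (q : nat) (mup mun : {measure set pt -> \bar R})
  (B : set pt) : R :=
  nu_int mup mun (angle a b) (fun z => Omega a b q z B)
  + chg mup mun (B `\` angle a b).

Definition balayage_exists (a b : R) (q : nat)
  (mup mun : {measure set pt -> \bar R}) : Prop :=
  (forall B, bounded_borel B ->
     nu_integrable mup mun (angle a b) (fun z => Omega a b q z B)) /\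
  (forall (B : set pt) (F : nat -> set pt), bounded_borel B ->
     (forall n, measurable (F n)) -> trivIset setT F ->
     \bigcup_n F n = B ->
     (fun n => \sum_(0 <= k < n) balayage a b q mup mun (F k))%R @ \oo
       --> balayage a b q mup mun B).

Definition blaschke_int (a b s r0 : R) (mup mun : {measure set pt -> \bar R})
  (r : R) : R :=
  nu_int mup mun ((odisc r `\` odisc r0) `&` angle a b)
    (fun z => complex.Im ((rotpow a b s z)^-1)%C).

End Defs.

(* Main.v *)
Require Import Defs.
From HB Require Import structures.
From mathcomp Require Import all_boot all_order all_algebra.
From mathcomp Require Import all_classical all_reals all_analysis.
From mathcomp Require Import complex.
From mathcomp Require Import measurable_realfun ring lra.
Import Defs Order.TTheory GRing.Theory Num.Theory.
Import numFieldNormedType.Exports.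
Local Open Scope classical_set_scope.
Local Open Scope ring_scope.
Set Implicit Arguments. Unset Strict Implicit. Unset Printing Implicit Defensive.

(* Write [kap = pi / (b - a)], [w = ztilde z] (so [|w| = |z|^kap]) and [rho = r^kap].
   Finite type together with the Hahn decomposition bounds both variations of the
   charge by [A r^p] for every [r > 0], and both vanish on the disc of radius [r0].
   By doubling of radii, the integral of [|z|^-s] outside the disc of radius [x]
   is [O(x^(p-s))] for [s > p]; inside it is [O(x^(p-s))] for [s < p] and
   logarithmic for [s = p].

   The density of the harmonic charge of genus [q] at [t] is
   [Im (t^q / (w^q (t - w))) / pi].  For [|w| >= 2 rho] and [|t| <= rho] it is at
   most [2 rho^q / |w|^(q+1)], and [kap (q + 1) > p], so far points contribute
   [O(r^p)].  For [|w| < 2 rho] it is split into the Poisson kernel, of total mass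
   at most 1, and the terms [Im (w^-k) t^(k-1)] with [1 <= k <= q]: integrating
   [t^(k-1)] over [|t| <= rho] gives [O(rho^k)], and the remaining integral of
   [Im (w^-k)] is [O(r^(p - kap k))] when [kap k < p].  Only for [k = q] must
   cancellation be kept; that integral differs from the Blaschke integral by the
   contribution of an annulus, which is [O(r^(p - kap q))]. *)

(** * Polar coordinates and the argument *)

(** The total variation of the balayage is a supremum over finite disjoint families, and no Jordan
    decomposition of the balayage is constructed. Estimates are therefore made for sums over a whole
    family, with constants that depend neither on the family nor on its length. The obstacle is the
    critical case [kap * q = p]: for [k = q] the absolute value may be taken only after [mup] and
    [mun] have been subtracted, yet a total variation asks for absolute values set by set. Both are
    possible because a correction term is a function of [z] times a moment of the set: the family
    acts on the moments alone, the cancellation on the integral in [z] alone. The Poisson part, the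
    far part and the charge outside the angle tolerate a separate estimate for each variation. The
    floor is used as [kap * q <= p < kap * (q + 1)]: the right inequality gives convergence at
    infinity, the left one controls the correction terms near the origin. The factor 2 in
    [|w| = 2 rho] keeps [t] and [w] apart by at least [|w| / 2]. *)

Section PolarCoordinates.
Variable R : realType.
Implicit Types (z : pt R) (r th m a b s : R).

Lemma modz_ge0 z : 0 <= modz z.
Proof. exact: sqrtr_ge0. Qed.

Lemma modz_polar r th : 0 <= r -> modz (polar r th) = r.
Proof.
move=> r0; rewrite /modz /polar /= !exprMn -mulrDr cos2Dsin2 mulr1.
by rewrite sqrtr_sqr ger0_norm.
Qed.

Lemma measurable_fun_modz : measurable_fun setT (@modz R).
Proof.
rewrite (_ : @modz R = fun z => (z.1 ^+ 2 + z.2 ^+ 2) `^ 2^-1); last first.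
  by apply/funext => z; rewrite powR12_sqrt// addr_ge0// sqr_ge0.
apply: (measurableT_comp (f := fun x : R => x `^ 2^-1)); first exact: measurable_powR.
by apply: measurable_funD; apply: measurable_funX.
Qed.

Lemma measurable_modz_powR (D : set (pt R)) (s : R) :
  measurable_fun D (fun z : pt R => modz z `^ s).
Proof.
apply: measurable_funTS.
apply: (measurableT_comp (f := fun x : R => x `^ s)); first exact: measurable_powR.
exact: measurable_fun_modz.
Qed.

(** The real power with exponent -1 agrees with the inverse even at 0, both being 0 there, so zeros
    of [f] need no separate treatment. *)
Lemma measurable_fun_inv (d : measure_display) (T : measurableType d)
    (f : T -> R) : (forall x, 0 <= f x) ->
  measurable_fun setT f -> measurable_fun setT (fun x => (f x)^-1).
Proof.
move=> f0 mf; rewrite (_ : (fun _ => _) = fun x => f x `^ (-1)); last first.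
  by apply/funext => x; rewrite powR_inv1.
exact: (measurableT_comp (f := fun x : R => x `^ (-1)) (@measurable_powR R _)).
Qed.

(* Half-angle formula: [tan (phi / 2) = sin phi / (1 + cos phi)] recovers the
   argument within [pi] of [m]. *)
Definition arg_near m z : R :=
  m + 2 * atan ((z.2 * cos m - z.1 * sin m) /
                (modz z + (z.1 * cos m + z.2 * sin m))).

Lemma measurable_arg_near m : measurable_fun setT (arg_near m).
Proof.
apply: measurable_funD => //; apply: measurable_funM => //.
apply: (measurableT_comp (f := @atan R)).
  apply: continuous_measurable_fun; exact: continuous_atan.
have m1 : measurable_fun setT (fun z : pt R => z.1) by exact: measurable_fst.
have m2 : measurable_fun setT (fun z : pt R => z.2) by exact: measurable_snd.
apply: measurable_funM.
  by apply: measurable_funB; apply: measurable_funM.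
apply: measurable_fun_inv.
  (* The denominator is nonnegative by Cauchy-Schwarz, seen after squaring from [|z|^2 - (x cos m +
     y sin m)^2 = (x sin m - y cos m)^2]. *)
  move=> z; rewrite -lerBlDr sub0r.
  have [h|h] := leP 0 (z.1 * cos m + z.2 * sin m).
    by rewrite (@le_trans _ _ 0) ?oppr_le0 ?modz_ge0.
  rewrite -(@ler_pXn2r _ 2%N) ?nnegrE ?modz_ge0 ?oppr_ge0 ?(ltW h)//.
  rewrite sqr_sqrtr ?addr_ge0 ?sqr_ge0// -subr_ge0.
  have -> : z.1 ^+ 2 + z.2 ^+ 2 - (- (z.1 * cos m + z.2 * sin m)) ^+ 2 =
    (z.1 * sin m - z.2 * cos m) ^+ 2.
    rewrite -(mulr1 (z.1 ^+ 2 + _)) -(cos2Dsin2 m); ring.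
  exact: sqr_ge0.
apply: measurable_funD; first exact: measurable_fun_modz.
by apply: measurable_funD; apply: measurable_funM.
Qed.

Lemma arg_near_polar m r th : 0 < r -> `|th - m| < pi ->
  arg_near m (polar r th) = th.
Proof.
move=> r0 hth; rewrite /arg_near modz_polar ?(ltW r0)//=.
have -> : r * sin th * cos m - r * cos th * sin m = r * sin (th - m).
  by rewrite sinB; ring.
have -> : r * cos th * cos m + r * sin th * sin m = r * cos (th - m).
  by rewrite cosB; ring.
set x := (th - m) / 2.
have -> : th - m = x *+ 2 by rewrite /x; lra.
have hx : x \in `]- (pi / 2), (pi / 2)[.
  by rewrite in_itv/= /x; move: hth; rewrite ltr_norml => /andP[]; lra.
have c0 : 0 < cos x by apply: cos_gt0_pihalf; move: hx; rewrite in_itv.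
rewrite sin_mulr2n cos_mulr2n.
have -> : r * ((cos x * sin x) *+ 2) / (r + r * (cos x ^+ 2 *+ 2 - 1)) = tan x.
  rewrite /tan; field; rewrite !gt_eqF//=.
  by rewrite [ltRHS](_ : _ = 2 * (r * cos x ^+ 2)); [rewrite !mulr_gt0|ring].
by rewrite tanK// /x; lra.
Qed.

Lemma norm_mid a b th : a < th < b -> b <= a + 2 * pi ->
  `|th - (a + b) / 2| < pi.
Proof. by move=> /andP[? ?] ?; rewrite ltr_norml; apply/andP; split; lra. Qed.

(** [arg_in] is a choice; it is pinned down because every admissible argument lies less than [pi]
    from the midpoint of [a] and [b], where [arg_near] inverts [polar]. The interval is open, so
    [b = a + 2 * pi] is included. *)
Lemma arg_in_polar a b r th : b <= a + 2 * pi -> 0 < r -> a < th < b ->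
  arg_in a b (polar r th) = th.
Proof.
move=> hb r0 hth; rewrite /arg_in.
case: xgetP => [y _ [hy /= yE]|/(_ th)/=]; last first.
  by case; split=> //; rewrite modz_polar ?ltW.
rewrite modz_polar ?(ltW r0)// in yE.
by rewrite -(arg_near_polar r0 (norm_mid hy hb)) -yE arg_near_polar// norm_mid.
Qed.

Lemma angleP a b z : b <= a + 2 * pi -> angle a b z ->
  [/\ 0 < modz z, a < arg_in a b z < b, z = polar (modz z) (arg_in a b z) &
      arg_in a b z = arg_near ((a + b) / 2) z].
Proof.
move=> hb [r [th [r0 [hth ->]]]]; rewrite arg_in_polar// modz_polar ?(ltW r0)//.
by split=> //; rewrite arg_near_polar// norm_mid.
Qed.

(** Taking [arg_near] at the midpoint as witness turns the existential definition into inequalities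
    and equations between measurable functions. *)
Lemma measurable_angle a b : b <= a + 2 * pi -> measurable (angle a b).
Proof.
move=> hb; pose g := @arg_near ((a + b) / 2).
have mg : measurable_fun setT g := measurable_arg_near _.
have -> : angle a b = [set z | [&& 0 < modz z, a < g z, g z < b,
    z.1 == modz z * cos (g z) & z.2 == modz z * sin (g z)]].
  apply/seteqP; split=> z /=.
    move=> /(angleP hb)[z0 /andP[az zb] zE gE].
    rewrite /g -gE z0 az zb /=.
    by apply/andP; split; apply/eqP; rewrite [in LHS]zE.
  case/and5P => z0 az zb /eqP h1 /eqP h2.
  exists (modz z), (g z); split=> //; split; first by rewrite az.
  by rewrite /polar -h1 -h2; case: (z).
have mc (h : R -> R) : continuous h -> measurable_fun setT (fun z => modz z * h (g z)).
  move=> ch; apply: measurable_funM; first exact: measurable_fun_modz.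
  by apply: (measurableT_comp (f := h)) => //; exact: continuous_measurable_fun.
have m1 : measurable_fun setT (fun z : pt R => z.1) by exact: measurable_fst.
have m2 : measurable_fun setT (fun z : pt R => z.2) by exact: measurable_snd.
have K (f : pt R -> bool) : measurable_fun setT f -> measurable [set z | f z].
  by move=> mf; rewrite -[X in measurable X]setTI; apply: mf.
apply: K; do ! apply: measurable_and.
- by apply: measurable_fun_ltr => //; exact: measurable_fun_modz.
- exact: measurable_fun_ltr.
- exact: measurable_fun_ltr.
- by apply: measurable_fun_eqr => //; apply: mc; exact: continuous_cos.
- by apply: measurable_fun_eqr => //; apply: mc; exact: continuous_sin.
Qed.

End PolarCoordinates.

(** * Powers of rotated points and the genus-q kernel *)

Section RotatedPowers.
Variables (R : realType) (a b : R).
Implicit Types (z : pt R) (s : R).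

Lemma Im_rotpowV s z : 0 < modz z ->
  complex.Im ((rotpow a b s z)^-1)%C =
  - (modz z `^ (- s) * sin (s * (arg_in a b z - a))).
Proof.
move=> z0; rewrite /rotpow /=.
set r := modz z `^ s; set x := s * _.
have r0 : 0 < r by exact: powR_gt0.
rewrite powRN -/r !exprMn -mulrDr cos2Dsin2; field.
by rewrite gt_eqF.
Qed.

Lemma ler_norm_Im_rotpowV s z : 0 < modz z ->
  `|complex.Im ((rotpow a b s z)^-1)%C| <= modz z `^ (- s).
Proof.
move=> z0; rewrite Im_rotpowV// normrN normrM ger0_norm ?powR_ge0//.
by rewrite ler_piMr ?powR_ge0// ler_norml sin_geN1 sin_le1.
Qed.

Lemma rotpowX s z k : 0 < modz z ->
  (rotpow a b s z ^+ k)%C = rotpow a b (s * k%:R) z.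
Proof.
move=> z0; elim: k => [|k IH].
  by rewrite expr0 mulr0 /rotpow !mul0r powRr0 cos0 sin0 mulr1 mulr0.
have -> : s * k.+1%:R = s * k%:R + s by rewrite -natr1; ring.
rewrite exprS IH /rotpow mulrDl cosD sinD.
rewrite powRD; last by rewrite (gt_eqF z0) implybT.
by congr (_ +i* _)%C; ring.
Qed.

Lemma normc_rotpow s z : ComplexField.Normc.normc (rotpow a b s z) = modz z `^ s.
Proof.
rewrite /rotpow /= !exprMn -mulrDr cos2Dsin2 mulr1 sqrtr_sqr ger0_norm//.
exact: powR_ge0.
Qed.

Lemma Im_ztildeVX k z : 0 < modz z ->
  complex.Im ((ztilde a b z) ^- k)%C =
  complex.Im ((rotpow a b (pi / (b - a) * k%:R) z)^-1)%C.
Proof. by move=> z0; rewrite /ztilde rotpowX. Qed.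

Hypotheses (ab : a < b) (hb : b <= a + 2 * pi).

Lemma Im_ztilde_gt0 z : angle a b z -> 0 < complex.Im (ztilde a b z).
Proof.
move=> /(angleP hb)[z0 /andP[az zb] _ _]; rewrite /ztilde /rotpow /=.
rewrite mulr_gt0 ?powR_gt0//; apply: sin_gt0_pi.
have ba : 0 < b - a by rewrite subr_gt0.
rewrite mulr_gt0 ?divr_gt0 ?pi_gt0 ?subr_gt0//=.
rewrite mulrAC ltr_pdivrMr// ltr_pM2l ?pi_gt0//; lra.
Qed.

Let argm z := arg_near ((a + b) / 2) z.

Let measurable_scaled_arg s (h : R -> R) : continuous h ->
  measurable_fun setT (fun z : pt R => h (s * (argm z - a))).
Proof.
move=> ch; apply: (measurableT_comp (f := h)).
  exact: continuous_measurable_fun.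
apply: measurable_funM => //; apply: measurable_funB => //.
exact: measurable_arg_near.
Qed.

Lemma measurable_Im_rotpowV s : measurable_fun (angle a b)
  (fun z => complex.Im ((rotpow a b s z)^-1)%C).
Proof.
apply: (@eq_measurable_fun _ _ _ _ _
    (fun z : pt R => - (modz z `^ (- s) * sin (s * (argm z - a))))).
  move=> z; rewrite inE => /(angleP hb)[z0 _ _ gE].
  by rewrite Im_rotpowV// gE.
apply: measurable_funTS; apply: measurable_funN; apply: measurable_funM; first exact: measurable_modz_powR.
by apply: measurable_scaled_arg; exact: continuous_sin.
Qed.

(** A version of [ztilde] that is measurable on the whole plane, with [arg_near] in place of the
    choice [arg_in]; Tonelli's theorem will ask for an integrand on the full product. *)
Definition ztilde_ext z : R * R :=
  let s := pi / (b - a) in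
  (modz z `^ s * cos (s * (argm z - a)), modz z `^ s * sin (s * (argm z - a))).

Lemma ztilde_extE z : angle a b z ->
  ztilde a b z = ((ztilde_ext z).1 +i* (ztilde_ext z).2)%C.
Proof. by move=> /(angleP hb)[z0 _ _ gE]; rewrite /ztilde /rotpow gE. Qed.

Lemma measurable_ztilde_ext1 : measurable_fun setT (fun z => (ztilde_ext z).1).
Proof.
apply: measurable_funM; first exact: measurable_modz_powR.
by apply: measurable_scaled_arg; exact: continuous_cos.
Qed.

Lemma measurable_ztilde_ext2 : measurable_fun setT (fun z => (ztilde_ext z).2).
Proof.
apply: measurable_funM; first exact: measurable_modz_powR.
by apply: measurable_scaled_arg; exact: continuous_sin.
Qed.

End RotatedPowers.

Section Kernel.
Variable R : realType.
Implicit Types (w : R[i]) (t rho : R).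
Local Notation normc := ComplexField.Normc.normc.

Definition poisson w t : R := complex.Im ((t%:C - w)^-1)%C.

Definition kern (q : nat) w t : R :=
  poisson w t + \sum_(1 <= k < q.+1) complex.Im (w ^- k)%C * t ^+ k.-1.

Lemma poissonE w t :
  poisson w t = complex.Im w / ((t - complex.Re w) ^+ 2 + complex.Im w ^+ 2).
Proof.
by case: w => x y; rewrite /poisson /= sub0r sqrrN mulNr opprK.
Qed.

Lemma poisson_ge0 w t : 0 <= complex.Im w -> 0 <= poisson w t.
Proof. by move=> h; rewrite poissonE divr_ge0// addr_ge0 ?sqr_ge0. Qed.

Lemma ImD (x y : R[i]) : complex.Im (x + y) = complex.Im x + complex.Im y.
Proof. by case: x y => [x1 x2] [y1 y2]. Qed.

Lemma ImM_real (x : R[i]) t : complex.Im (x * t%:C)%C = complex.Im x * t.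
Proof. by case: x => [x1 x2] /=; rewrite mulr0 add0r. Qed.

(* Telescoping of the geometric series of [1 / (t - w)] in powers of [t / w]. *)
Lemma kernE q w t : w != 0 -> (t%:C - w)%C != 0 ->
  kern q w t = complex.Im (t%:C ^+ q / (w ^+ q * (t%:C - w)))%C.
Proof.
move=> w0 tw; elim: q => [|q IH].
  by rewrite /kern big_geq// addr0 !expr0 !mul1r.
rewrite /kern big_nat_recr//= addrA -/(kern q w t) IH.
rewrite -ImM_real rmorphXn -ImD; congr complex.Im.
rewrite !exprS; field; by rewrite w0 expf_neq0//= andbT.
Qed.

Lemma normcX w n : normc (w ^+ n) = normc w ^+ n.
Proof.
elim: n => [|n IH]; first by rewrite !expr0 ComplexField.Normc.normc1.
by rewrite !exprS ComplexField.Normc.normcM IH.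
Qed.

Lemma normc_real t : normc (t%:C)%C = `|t|.
Proof. by rewrite /= expr0n addr0 sqrtr_sqr. Qed.

Lemma ler_norm_Im_normc w : `|complex.Im w| <= normc w.
Proof.
case: w => x y /=; rewrite -sqrtr_sqr ler_sqrt ?addr_ge0 ?sqr_ge0//.
by rewrite lerDr sqr_ge0.
Qed.

(** In the closed form of [kernE] only [1 / (t - w)] needs care: [|t| <= |w| / 2] forces
    [|t - w| >= |w| / 2], whence the constant 2. *)
Lemma kern_far q w t rho : 0 < rho -> `|t| <= rho -> 2 * rho <= normc w ->
  `|kern q w t| <= 2 * rho ^+ q / normc w ^+ q.+1.
Proof.
move=> r0 ht hw.
have w0 : 0 < normc w by apply: lt_le_trans hw; rewrite mulr_gt0.
have wn0 : w != 0.
  by apply: contraTneq w0 => ->; rewrite ComplexField.Normc.normc0 ltxx.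
have htw : normc w / 2 <= normc (t%:C - w)%C.
  have := le_normcD (t%:C - w)%C (- t%:C)%C.
  rewrite normcN normc_real addrAC subrr add0r normcN; lra.
have twn0 : (t%:C - w)%C != 0.
  apply/eqP => h; move: htw; rewrite h ComplexField.Normc.normc0; lra.
rewrite kernE//; apply: le_trans (ler_norm_Im_normc _) _.
rewrite ComplexField.Normc.normcM ComplexField.Normc.normcV.
rewrite ComplexField.Normc.normcM !normcX normc_real.
set n := normc (t%:C - w)%C in htw *.
set W := normc w in w0 htw *.
have n0 : 0 < n by apply: lt_le_trans htw; rewrite divr_gt0.
rewrite ler_pdivrMr ?mulr_gt0 ?exprn_gt0//.
have -> : 2 * rho ^+ q / W ^+ q.+1 * (W ^+ q * n) = rho ^+ q * (2 * n / W).
  by rewrite exprS; field; rewrite gt_eqF//= expf_neq0// gt_eqF.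
apply: (@le_trans _ _ (rho ^+ q)).
  by rewrite lerXn2r// nnegrE ltW.
by rewrite ler_peMr ?exprn_ge0 ?(ltW r0)// ler_pdivlMr//; lra.
Qed.

End Kernel.

(** * Power integrals against a measure of growth r^p *)

Section PowerGrowth.
Variable R : realType.

Lemma measurable_odisc (r : R) : measurable (odisc r).
Proof.
rewrite -[X in measurable X]setTI.
have := measurable_fun_modz (R := R).
by move=> /(_ measurableT _ (measurable_itv `]-oo, r[)); congr measurable; apply/seteqP; split => z /=; rewrite in_itv.
Qed.

Lemma measurable_cdisc (r : R) : measurable (cdisc r).
Proof.
rewrite -[X in measurable X]setTI.
have := measurable_fun_modz (R := R).
by move=> /(_ measurableT _ (measurable_itv `]-oo, r])); congr measurable; apply/seteqP; split => z /=; rewrite in_itv.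
Qed.

Lemma ler_powRN (x y s : R) : 0 < x -> 0 <= s -> x <= y -> y `^ (- s) <= x `^ (- s).
Proof.
move=> x0 s0 xy; rewrite !powRN lef_pV2 ?posrE ?powR_gt0 ?(lt_le_trans x0)//.
by rewrite ge0_ler_powR ?nnegrE// ?(le_trans _ xy)// ltW.
Qed.

Lemma powR_pos_add (x u v : R) : 0 < x -> x `^ u * x `^ v = x `^ (u + v).
Proof. by move=> x0; rewrite powRD// (gt_eqF x0) implybT. Qed.

Lemma powR_lt1 (x u : R) : 0 < x < 1 -> 0 < u -> x `^ u < 1.
Proof.
move=> /andP[x0 x1] u0.
have : x `^ u < 1 `^ u by rewrite gt0_ltr_powR ?nnegrE// ltW.
by rewrite powR1.
Qed.

Variables (mu : {measure set (pt R) -> \bar R}) (A p r0 : R).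
Hypotheses (A0 : 0 <= A) (p0 : 0 <= p) (r00 : 0 < r0).
Hypothesis mu_null : mu (odisc r0) = 0%E.
Hypothesis mu_growth : forall r : R, 0 < r -> (mu (cdisc r) <= (A * r `^ p)%:E)%E.

Local Notation powint D s := (\int[mu]_(z in D) (modz z `^ (- s))%:E)%E.

(** Deliberately crude: the mass of the whole closed disc of radius [y] replaces that of [D], which
    costs only a constant on dyadic shells. *)
Lemma growth_integral_annulus (D : set (pt R)) (x y s : R) : 0 < x -> 0 < y -> 0 <= s ->
  measurable D -> (forall z, D z -> x <= modz z <= y) ->
  (powint D s <= (x `^ (- s) * (A * y `^ p))%:E)%E.
Proof.
move=> x0 y0 s0 mD Dz.
apply: (@le_trans _ _ (\int[mu]_(z in D) cst (x `^ (- s))%:E z)%E).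
  apply: ge0_le_integral => //.
  - by move=> z _; rewrite lee_fin powR_ge0.
  - by apply/measurable_EFinP; exact: measurable_modz_powR.
  - by move=> z /Dz /andP[xz _]; rewrite lee_fin ler_powRN.
rewrite integral_cst// EFinM lee_pmul2l ?lte_fin ?powR_gt0//.
apply: le_trans (mu_growth y0).
apply: le_measure; rewrite ?inE//; first exact: measurable_cdisc.
by move=> z /Dz/andP[].
Qed.

Let measurable_powint D s : measurable_fun D (fun z : pt R => (modz z `^ (- s))%:E).
Proof. by apply/measurable_EFinP; exact: measurable_modz_powR. Qed.

Let powint_setU (D E : set (pt R)) (s : R) : measurable D -> measurable E ->
  [disjoint D & E] -> powint (D `|` E) s = (powint D s + powint E s)%E.
Proof.
move=> mD mE DE; apply: ge0_integral_setU => //.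
by move=> z _; rewrite lee_fin powR_ge0.
Qed.

Lemma growth_integral_inner (x s : R) : x <= r0 -> powint (odisc x) s = 0%E.
Proof.
move=> xr; apply: null_set_integral => //; first exact: measurable_odisc.
apply/eqP; rewrite eq_le measure_ge0 andbT -mu_null.
apply: le_measure; rewrite ?inE; [exact: measurable_odisc..|].
by move=> z /= h; exact: lt_le_trans xr.
Qed.

(** [L] is a supersolution of the recursion that adds one dyadic shell per doubling of the radius.
    It starts on radii from [r0 / 2] to [r0], where the integral vanishes, and [N] doublings reach
    [2 ^+ N * r0]. The power bound and the logarithmic bound share this induction. *)
Lemma growth_integral_head_rec (L : R -> R) (s : R) : 0 <= s ->
  (forall x : R, r0 <= x -> 0 <= L (x / 2) /\
     L (x / 2) + (x / 2) `^ (- s) * (A * x `^ p) <= L x) ->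
  forall x : R, r0 / 2 <= x -> (powint (odisc x) s <= (L x)%:E)%E.
Proof.
move=> s0 HL.
have L0 x : r0 / 2 <= x -> 0 <= L x.
  move=> hx; have -> : x = 2 * x / 2 by field.
  by have /HL[] : r0 <= 2 * x by lra.
have base x : r0 / 2 <= x -> x <= r0 -> (powint (odisc x) s <= (L x)%:E)%E.
  by move=> h1 h2; rewrite growth_integral_inner// lee_fin L0.
suff H N x : r0 / 2 <= x -> x <= 2 ^+ N * r0 -> (powint (odisc x) s <= (L x)%:E)%E.
  move=> x hx; apply: (H (Num.Def.archi_bound (x / r0))) => //.
  by rewrite -ler_pdivrMr// ltW// upper_nthrootP.
elim: N x => [|N IH] x hx; first by rewrite expr0 mul1r; exact: base.
move=> hxN; have [xr|rx] := leP x r0; first exact: base.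
have [_ HLx] := HL x (ltW rx).
have x0 : 0 < x by exact: lt_trans rx.
have -> : odisc x = odisc (x / 2) `|` (odisc x `\` odisc (x / 2)).
  by rewrite setDE setUIr setUv setIT; apply/seteqP; split => z /=; [right|case] => //; rewrite /odisc/=; lra.
rewrite powint_setU; last first.
- by apply/disj_setPS => z [? []].
- by apply: measurableD; exact: measurable_odisc.
- exact: measurable_odisc.
apply: (@le_trans _ _ ((L (x / 2))%:E + ((x / 2) `^ (- s) * (A * x `^ p))%:E)%E);
  last by rewrite -EFinD lee_fin.
apply: leeD.
  by apply: IH; [lra|move: hxN; rewrite exprS; lra].
apply: growth_integral_annulus => //; first lra.
  by apply: measurableD; exact: measurable_odisc.
by move=> z [/= h1 /negP]; rewrite -leNgt => h2; rewrite h2 ltW.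
Qed.

Lemma growth_integral_head (s : R) : 0 <= s -> s < p -> exists2 C : R, 0 <= C &
  forall x : R, 0 < x -> (powint (odisc x) s <= (C * x `^ (p - s))%:E)%E.
Proof.
move=> s0 sp; set h := (2^-1 : R) `^ (p - s).
have h1 : h < 1 by apply: powR_lt1; [rewrite invr_gt0 invf_lt1|]; lra.
(* [C] solves [C * h + 2^s * A = C]: the shells form a geometric series of ratio [h], and the
   recursion holds with equality. *)
pose C := (2^-1 : R) `^ (- s) * A / (1 - h).
have C0 : 0 <= C by rewrite divr_ge0 ?mulr_ge0 ?powR_ge0//; lra.
exists C => // x x0.
have [xr|rx] := ltP x r0.
  by rewrite growth_integral_inner ?(ltW xr)// lee_fin mulr_ge0 ?powR_ge0.
apply: (growth_integral_head_rec (L := fun x => C * x `^ (p - s))) => //; last lra.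
move=> y yr; split; first by rewrite mulr_ge0 ?powR_ge0.
have y0 : 0 < y by exact: lt_le_trans yr.
rewrite !powRM ?(ltW y0) ?invr_ge0// -/h.
have -> : y `^ p = y `^ (p - s) * y `^ s by rewrite powR_pos_add// subrK.
rewrite [y `^ (- s)]powRN.
have ys : 0 < y `^ s by rewrite powR_gt0.
rewrite le_eqVlt; apply/orP; left; apply/eqP.
(* This expresses [2^s] through [C]; the conditional covers [A = 0], where [C = 0] does not
   determine it. *)
have -> : (2^-1 : R) `^ (- s) = C * (1 - h) / (if A == 0 then 1 else A) + (if A == 0 then (2^-1 : R) `^ (- s) else 0).
  rewrite /C; case: eqP => [->|/eqP An]; first by field; lra.
  by field; rewrite An /=; lra.
rewrite /C; case: eqP => [->|/eqP An]; first by rewrite !(mulr0, mul0r) !addr0.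
by field; rewrite An /= gt_eqF//=; lra.
Qed.

(** At the critical exponent every dyadic shell contributes the same bound [c], so the estimate
    counts shells, about [log2 (x / r0) + 1] of them. The counting function is zero at [r0 / 2],
    where the recursion may start. *)
Lemma growth_integral_log : exists2 C : R, 0 <= C &
  forall x : R, r0 <= x -> (powint (odisc x) p <= (C * (ln x - ln r0 + 1))%:E)%E.
Proof.
have l2 : 0 < ln 2 :> R by rewrite ln_gt0// ltr1n.
pose c := (2^-1 : R) `^ (- p) * A.
have c0 : 0 <= c by rewrite mulr_ge0 ?powR_ge0.
exists (c / ln 2 + c); first by rewrite addr_ge0// divr_ge0// ltW.
move=> x rx; have x0 : 0 < x by exact: lt_le_trans rx.
apply: (@le_trans _ _ ((c * ((ln x - ln r0) / ln 2 + 1))%:E)%E).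
  apply: (growth_integral_head_rec (L := fun x => c * ((ln x - ln r0) / ln 2 + 1))) => //; last lra.
  move=> y yr; have y0 : 0 < y by exact: lt_le_trans yr.
  have lny : ln (y / 2) = ln y - ln 2 by rewrite ln_div ?posrE.
  have lr : ln r0 <= ln y by rewrite ler_ln ?posrE.
  split.
    rewrite mulr_ge0// lny (_ : _ + 1 = (ln y - ln r0) / ln 2); last by field; lra.
    by rewrite divr_ge0 ?(ltW l2)//; lra.
  rewrite !powRM ?(ltW y0) ?invr_ge0// [y `^ (- p)]powRN lny.
  have yp : 0 < y `^ p by rewrite powR_gt0.
  rewrite le_eqVlt; apply/orP; left; apply/eqP; rewrite /c.
  by field; rewrite !gt_eqF.
have lr : ln r0 <= ln x by rewrite ler_ln ?posrE.
rewrite lee_fin -subr_ge0.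
rewrite (_ : _ - _ = c / ln 2 + c * (ln x - ln r0)); last by field; lra.
by rewrite addr_ge0 ?divr_ge0 ?mulr_ge0 ?(ltW l2)//; lra.
Qed.

Lemma growth_integral_tail (s : R) : p < s -> exists2 C : R, 0 <= C &
  forall x : R, 0 < x -> (powint (~` odisc x) s <= (C * x `^ (p - s))%:E)%E.
Proof.
move=> ps; have s0 : 0 <= s by rewrite ltW// (le_lt_trans p0).
set h := (2 : R) `^ (p - s).
have h1 : h < 1.
  rewrite /h (_ : p - s = -1 * (s - p)); last by ring.
  by rewrite powRrM powR_inv1//; apply: powR_lt1; [rewrite invr_gt0 invf_lt1|]; lra.
(* Again a fixed point: the first shell gives [2^p * A], and the rest is the same bound at [2 * x],
   smaller by the factor [h]. *)
pose C := 2 `^ p * A / (1 - h).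
have C0 : 0 <= C by rewrite divr_ge0 ?mulr_ge0 ?powR_ge0//; lra.
have mD x y : measurable (odisc x `\` odisc y : set (pt R)).
  by apply: measurableD; exact: measurable_odisc.
have step N x : 0 < x ->
    (powint (odisc (2 ^+ N * x) `\` odisc x) s <= (C * x `^ (p - s))%:E)%E.
  elim: N x => [|N IH] x x0.
    rewrite expr0 mul1r setDv integral_set0 lee_fin.
    by rewrite mulr_ge0 ?powR_ge0.
  have x2 : 0 < 2 * x by rewrite mulr_gt0.
  apply: (@le_trans _ _ (powint ((odisc (2 * x) `\` odisc x) `|`
     (odisc (2 ^+ N * (2 * x)) `\` odisc (2 * x))) s)).
    apply: ge0_subset_integral => //; first exact: measurableU.
      by move=> z _; rewrite lee_fin powR_ge0.
    move=> z [/= h2 h3]; have [h4|h4] := ltP (modz z) (2 * x); [left|right]; split => //=.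
      by rewrite mulrA -exprSr.
    by apply/negP; rewrite -leNgt.
  rewrite powint_setU//; last by apply/disj_setPS => z [[? ?] []].
  apply: (@le_trans _ _ ((x `^ (- s) * (A * (2 * x) `^ p))%:E + (C * (2 * x) `^ (p - s))%:E)%E).
    apply: leeD; last exact: IH.
    apply: growth_integral_annulus => //.
    by move=> z [/= h2 /negP]; rewrite -leNgt => h3; rewrite h3 ltW.
  rewrite -EFinD lee_fin !powRM ?(ltW x0)// -/h.
  rewrite [x `^ (- s)]powRN.
  have -> : x `^ p = x `^ (p - s) * x `^ s by rewrite powR_pos_add// subrK.
  have xs : 0 < x `^ s by rewrite powR_gt0.
  rewrite le_eqVlt; apply/orP; left; apply/eqP; rewrite /C.
  by field; rewrite gt_eqF//=; lra.
exists C => // x x0.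
(* The bound on truncated tails is uniform in [N] and passes to the increasing union by monotone
   convergence. *)
have -> : ~` odisc x = \bigcup_N (odisc (2 ^+ N * x) `\` odisc x).
  apply/seteqP; split=> z /=; last by case=> N _ [].
  move=> h2; exists (Num.Def.archi_bound (modz z / x)) => //; split=> //=.
  by rewrite /odisc /= -ltr_pdivrMr// upper_nthrootP.
apply: (cvge_to_le (ge0_nondecreasing_set_cvg_integral _ _ _ _)) => //.
- move=> n m nm; apply/subsetPset => z [/= h2 h3]; split=> //=.
  apply: lt_le_trans h2 _; rewrite ler_pM2r//.
  by rewrite ler_weXn2l// ler1n.
- by move=> N z _; rewrite lee_fin powR_ge0.
- by apply: nearW => N; exact: step.
Qed.

End PowerGrowth.

(** * Integrals over the boundary line *)

Section SumNormIntegral.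
Context (d : measure_display) (T : measurableType d) (R : realType).
Variable mu : {measure set T -> \bar R}.

(** The bridge from a total variation to a single integral. It serves Lebesgue measure on the
    boundary line as well as the two variations of the charge. *)
Lemma sum_norm_Rintegral_le (D : set T) (n : nat) (F : nat -> set T) (g : T -> R) :
  measurable D ->
  (forall i, (i < n)%N -> measurable (F i) /\ F i `<=` D) ->
  trivIset [set i | (i < n)%N] F ->
  mu.-integrable D (EFin \o g) ->
  \sum_(i < n) `|Rintegral mu (F i) g| <= Rintegral mu D (fun x => `|g x|).
Proof.
move=> mD HF tF ig.
have ign : mu.-integrable D (EFin \o (fun x => `|g x|)).
  by have := integrable_norm ig.
rewrite -lee_fin fineK; last exact: integrable_fin_num.
rewrite -sumEFin.
have /measurable_EFinP mg : measurable_fun D (EFin \o (fun x => `|g x|)).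
  by case/integrableP : ign.
pose U := \big[setU/set0]_(i <- index_enum 'I_n) F i.
have UD : U `<=` D.
  rewrite /U => x; rewrite -bigcup_seq/= => -[i _]; exact: (HF i (ltn_ord i)).2.
apply: (@le_trans _ _ (\int[mu]_(x in U) (`|g x|)%:E)%E); last first.
  apply: ge0_subset_integral => //.
  - by apply: bigsetU_measurable => i _; exact: (HF i (ltn_ord i)).1.
  - by apply/measurable_EFinP.
rewrite ge0_integral_bigsetU//.
- apply: lee_sum => i _; have [mFi FiD] := HF i (ltn_ord i).
  have igi : mu.-integrable (F i) (EFin \o g) by exact: integrableS ig.
  rewrite EFin_normr_Rintegral//.
  have /integrableP[mgi _] := igi.
  exact: (le_abse_integral mu mFi mgi).
- by move=> i; exact: (HF i (ltn_ord i)).1.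
- exact: index_enum_uniq.
- move=> i j _ _ /= h; apply/val_inj; apply: tF => //=; exact: ltn_ord.
- by apply/measurable_EFinP; exact: measurable_funS mg.
Qed.

Lemma sum_norm_Rintegral_bounded (D : set T) (n : nat) (F : nat -> set T)
    (g : T -> R) (M : R) :
  measurable D -> (mu D < +oo)%E ->
  (forall i, (i < n)%N -> measurable (F i) /\ F i `<=` D) ->
  trivIset [set i | (i < n)%N] F ->
  mu.-integrable D (EFin \o g) -> (forall x, D x -> `|g x| <= M) ->
  \sum_(i < n) `|Rintegral mu (F i) g| <= M * fine (mu D).
Proof.
move=> mD Doo HF tF ig gM.
apply: le_trans (sum_norm_Rintegral_le mD HF tF ig) _.
rewrite -Rintegral_cst//; apply: le_Rintegral => //.
- by have := integrable_norm ig.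
- apply/integrableP; split; first exact: measurable_cst.
  by rewrite (integral_cst _ mD) lte_mul_pinfty//= lee_fin.
Qed.

End SumNormIntegral.

Section BoundaryIntegrals.
Variable R : realType.
Implicit Types (w : R[i]) (rho t : R).
Local Notation lmu := (@lebesgue_measure R).

Lemma continuous_poisson w : 0 < complex.Im w -> continuous (poisson w).
Proof.
move=> w0; rewrite (_ : poisson w = fun t => complex.Im w *
    ((t - complex.Re w) ^+ 2 + complex.Im w ^+ 2)^-1); last first.
  by apply/funext => t; rewrite poissonE.
move=> t; apply: cvgM; first exact: cvg_cst.
apply: cvgV.
  by rewrite gt_eqF// ltr_wpDl ?sqr_ge0// exprn_gt0.
apply: cvgD; last exact: cvg_cst.
by apply: cvgM; apply: cvgB; [exact: cvg_id|exact: cvg_cst|exact: cvg_id|exact: cvg_cst].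
Qed.

Lemma continuous_integrable_itv (f : R -> R) rho : continuous f ->
  lmu.-integrable `[- rho, rho]%classic (EFin \o f).
Proof.
move=> cf; apply: continuous_compact_integrable; first exact: segment_compact.
exact: continuous_subspaceT.
Qed.

Lemma continuous_kern q w : 0 < complex.Im w -> continuous (kern q w).
Proof.
move=> w0 t; apply: cvgD; first exact: continuous_poisson.
apply: cvg_big; first exact: add_continuous.
move=> k _; apply: cvgM; first exact: cvg_cst.
exact: exprn_continuous.
Qed.

Lemma Rintegral_poisson_le w rho : 0 < rho -> 0 < complex.Im w ->
  Rintegral lmu `[- rho, rho]%classic (fun t => `|poisson w t|) <= pi.
Proof.
move=> r0 w0.
under eq_Rintegral do rewrite ger0_norm ?poisson_ge0 ?(ltW w0)//.
set x := complex.Re w; set y := complex.Im w in w0 *.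
(* An antiderivative of the Poisson kernel; its increments stay below [pi], the length of the range
   of the arctangent. *)
pose F t := atan ((t - x) / y).
have dF t : is_derive t 1 F (poisson w t).
  have h : is_derive t 1 (fun t => (t - x) / y) y^-1.
    by apply: is_derive_eq; rewrite scaler0 add0r subr0 [LHS]mulr1.
  have := @is_derive1_comp R atan (fun t => (t - x) / y) t _ _
    (is_derive1_atan _) h.
  move=> /is_derive_eq; apply; rewrite poissonE -/x -/y; field.
  have y2 : 0 < y ^+ 2 by rewrite exprn_gt0.
  by rewrite !gt_eqF// ltr_wpDl ?sqr_ge0 // ltr_wpDr ?sqr_ge0.
have cF t : {for t, continuous F}.
  apply: differentiable_continuous; apply/derivable1_diffP; by case: (dF t).
have dLR : derivable_oo_LRcontinuous F (- rho) rho.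
  split => [t _||]; first by case: (dF t).
    by apply: cvg_at_right_filter; exact: cF.
  by apply: cvg_at_left_filter; exact: cF.
have DF : {in `]- rho, rho[%R, F^`()%classic =1 poisson w}.
  by move=> t _; rewrite derive1E; by case: (dF t).
have rr : - rho < rho by rewrite gtrN.
rewrite /Rintegral (continuous_FTC2 rr _ dLR DF) /=; last first.
  by apply: continuous_subspaceT; exact: continuous_poisson.
rewrite /F.
have := atan_ltpi2 ((rho - x) / y); have := atan_gtNpi2 ((- rho - x) / y); lra.
Qed.

End BoundaryIntegrals.

(** * The boundary curve and harmonic charges *)

Section Boundary.
Variables (R : realType) (a b : R).
Hypotheses (ab : a < b) (hb : b <= a + 2 * pi).
Implicit Types (B : set (pt R)) (r t : R) (z : pt R).
Local Notation lmu := (@lebesgue_measure R).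
Local Notation kap := (pi / (b - a)).

Lemma kap_gt0 : 0 < kap.
Proof. by rewrite divr_gt0 ?pi_gt0// subr_gt0. Qed.

(** The real line wrapped around the boundary of the angle. For [b = a + 2 * pi] the map is
    two-to-one off the vertex, which is how the two sides of the slit remain distinct. *)
Definition bdry t : pt R :=
  polar (`|t| `^ ((b - a) / pi)) (if 0 <= t then a else b).

(** As a preimage, [Btilde] inherits measurability, disjointness and unions. The two clauses of its
    definition overlap at [t = 0], where both give the vertex because the exponent is nonzero. *)
Lemma BtildeE B : Btilde a b B = bdry @^-1` B.
Proof.
have l0 : (b - a) / pi != 0.
  by rewrite mulf_neq0 ?invr_neq0 ?gt_eqF ?pi_gt0 ?subr_gt0.
have pol0 x y : polar (`|0 : R| `^ ((b - a) / pi)) x = polar (`|0 : R| `^ ((b - a) / pi)) y.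
  by rewrite normr0 powR0// /polar !mul0r.
apply/seteqP; split => t /=; rewrite /bdry.
  case=> -[t0]; first by rewrite t0 ger0_norm.
  move=> h; move: t0; rewrite le_eqVlt => /orP[/eqP t0|t0].
    by rewrite t0 in h *; rewrite (pol0 _ b).
  by rewrite leNgt t0.
by case: leP => t0 h; [left; rewrite t0; rewrite ger0_norm in h|right; rewrite ltW].
Qed.

Lemma measurable_bdry : measurable_fun setT bdry.
Proof.
have mm : measurable_fun setT (fun t : R => `|t| `^ ((b - a) / pi)).
  apply: (measurableT_comp (f := fun x : R => x `^ ((b - a) / pi))).
    exact: measurable_powR.
  exact: normr_measurable.
have mi (h : R -> R) : measurable_fun setT (fun t : R => h (if 0 <= t then a else b)).
  rewrite (_ : (fun _ => _) = fun t : R => if 0 <= t then h a else h b); last first.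
    by apply/funext => t; case: ifP.
  by apply: measurable_fun_ifT => //; exact: measurable_fun_ler.
by apply: measurable_fun_pair; apply: measurable_funM.
Qed.

Lemma measurable_Btilde B : measurable B -> measurable (Btilde a b B).
Proof.
by move=> mB; rewrite BtildeE -[X in measurable X]setTI; exact: measurable_bdry.
Qed.

Lemma Btilde_sub_itv B r : 0 <= r -> B `<=` cdisc r ->
  Btilde a b B `<=` `[- r `^ kap, r `^ kap]%classic.
Proof.
move=> r0 Br t; rewrite BtildeE => /Br /=.
rewrite /bdry /cdisc /= modz_polar ?powR_ge0// => h.
rewrite in_itv /= -ler_norml.
have -> : `|t| = (`|t| `^ ((b - a) / pi)) `^ kap.
  rewrite -powRrM (_ : (b - a) / pi * kap = 1) ?powRr1//.
  by rewrite mulrA divfK ?divff// ?subr_eq0 ?(gt_eqF ab)// gt_eqF ?pi_gt0.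
by rewrite ge0_ler_powR ?nnegrE ?powR_ge0// ltW// kap_gt0.
Qed.

Lemma Btilde_trivIset (I : Type) (D : set I) (F : I -> set (pt R)) :
  trivIset D F -> trivIset D (fun i => Btilde a b (F i)).
Proof.
move=> tF i j Di Dj [t]; rewrite !BtildeE => -[h1 h2].
by apply: tF => //; exists (bdry t).
Qed.

Lemma Btilde_bigcup (F : nat -> set (pt R)) :
  Btilde a b (\bigcup_n F n) = \bigcup_n Btilde a b (F n).
Proof.
by rewrite BtildeE preimage_bigcup; apply: eq_bigcup => // n _; rewrite BtildeE.
Qed.

Let Btilde_family r n (F : nat -> set (pt R)) : 0 <= r ->
  (forall i, (i < n)%N -> measurable (F i) /\ F i `<=` cdisc r) ->
  forall i, (i < n)%N -> measurable (Btilde a b (F i)) /\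
    Btilde a b (F i) `<=` `[- r `^ kap, r `^ kap]%classic.
Proof.
move=> r0 HF i /HF[mF Fr]; split; first exact: measurable_Btilde.
exact: Btilde_sub_itv.
Qed.

Lemma integrable_Btilde r B (f : R -> R) : 0 <= r -> measurable B -> B `<=` cdisc r ->
  continuous f -> lmu.-integrable (Btilde a b B) (EFin \o f).
Proof.
move=> r0 mB Br cf; apply: integrableS (continuous_integrable_itv (r `^ kap) cf) => //.
  exact: measurable_Btilde.
exact: Btilde_sub_itv.
Qed.

Definition moment (k : nat) B : R := Rintegral lmu (Btilde a b B) (fun t => t ^+ k).

Definition poisson_charge z B : R :=
  pi^-1 * Rintegral lmu (Btilde a b B) (poisson (ztilde a b z)).

Lemma Omega_poisson_moment q z B : Omega a b q z B =
  poisson_charge z B + pi^-1 * \sum_(1 <= k < q.+1)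
    complex.Im ((ztilde a b z) ^- k)%C * moment k.-1 B.
Proof. by []. Qed.

(** Boundedness of [B] confines [Btilde] to a compact interval, so every monomial is integrable and
    the separate integrals merge into one. *)
Lemma Omega_kern q z r B : 0 <= r -> measurable B -> B `<=` cdisc r ->
  angle a b z ->
  Omega a b q z B = pi^-1 * Rintegral lmu (Btilde a b B) (kern q (ztilde a b z)).
Proof.
move=> r0 mB Br az; rewrite /Omega -mulrDr; congr (_ * _).
have w0 := Im_ztilde_gt0 ab hb az.
set w := ztilde a b z in w0 *.
have mBt := measurable_Btilde mB.
elim: q => [|q IH].
  rewrite big_geq// addr0; apply: eq_Rintegral => t _.
  by rewrite /kern big_geq// addr0.
rewrite big_nat_recr//= addrA IH -RintegralZl//; last first.
  by apply: (integrable_Btilde r0) => //; exact: exprn_continuous.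
rewrite -RintegralD//; last 2 first.
- by apply: (integrable_Btilde r0) => //; exact: continuous_kern.
- apply: (integrable_Btilde r0) => // t; apply: cvgM; first exact: cvg_cst.
  exact: exprn_continuous.
by apply: eq_Rintegral => t _; rewrite /kern [in RHS]big_nat_recr//= addrA.
Qed.

Section Families.
Variables (r : R) (n : nat) (F : nat -> set (pt R)).
Hypotheses (r0 : 0 < r)
  (HF : forall i, (i < n)%N -> measurable (F i) /\ F i `<=` cdisc r)
  (tF : trivIset [set i | (i < n)%N] F).

Let rho0 : 0 < r `^ kap.
Proof. exact: powR_gt0. Qed.

Let fine_itv : fine (lmu `[- r `^ kap, r `^ kap]%classic) = 2 * r `^ kap.
Proof.
rewrite lebesgue_measure_itv /= lte_fin gtrN//=; ring.
Qed.

Let itv_fin : (lmu `[(- r `^ kap)%R, (r `^ kap)%R]%classic < +oo)%E.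
Proof. by rewrite lebesgue_measure_itv /= lte_fin gtrN//= ltry. Qed.

Lemma sum_poisson_charge z : angle a b z ->
  \sum_(i < n) `|poisson_charge z (F i)| <= 1.
Proof.
move=> az; have w0 := Im_ztilde_gt0 ab hb az.
under eq_bigr do rewrite normrM.
rewrite -mulr_sumr ger0_norm ?invr_ge0 ?pi_ge0// ler_pdivrMl ?pi_gt0// mulr1.
apply: le_trans (Rintegral_poisson_le rho0 w0).
apply: (@sum_norm_Rintegral_le _ _ R lmu `[- r `^ kap, r `^ kap]%classic n (fun i => Btilde a b (F i)) (poisson (ztilde a b z))) => //.
- exact: (Btilde_family (ltW r0) HF).
- exact: Btilde_trivIset.
- exact/continuous_integrable_itv/continuous_poisson.
Qed.

Lemma sum_Rintegral_Btilde (f : R -> R) M : continuous f ->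
  (forall t, `|t| <= r `^ kap -> `|f t| <= M) ->
  \sum_(i < n) `|Rintegral lmu (Btilde a b (F i)) f| <= M * (2 * r `^ kap).
Proof.
move=> cf fM; rewrite -fine_itv; apply: (@sum_norm_Rintegral_bounded _ _ R lmu `[- r `^ kap, r `^ kap]%classic n (fun i => Btilde a b (F i))) => //.
- exact: (Btilde_family (ltW r0) HF).
- exact: Btilde_trivIset.
- exact: continuous_integrable_itv.
- by move=> t; rewrite /= in_itv/= -ler_norml; exact: fM.
Qed.

Lemma sum_moment k : \sum_(i < n) `|moment k (F i)| <= 2 * (r `^ kap) ^+ k.+1.
Proof.
rewrite exprS [leRHS](_ : _ = (r `^ kap) ^+ k * (2 * r `^ kap)); last by ring.
apply: sum_Rintegral_Btilde; first exact: exprn_continuous.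
by move=> t ht; rewrite normrX lerXn2r ?nnegrE ?powR_ge0.
Qed.

(** The constant 4 is the 2 of [kern_far] times the 2 in the length of the boundary interval; the
    factor [1 / pi] is simply bounded by 1. *)
Lemma sum_Omega_far q z : angle a b z -> 2 * r `^ kap <= modz z `^ kap ->
  \sum_(i < n) `|Omega a b q z (F i)| <=
  4 * (r `^ kap) ^+ q.+1 * modz z `^ (- (kap * q.+1%:R)).
Proof.
move=> az zr; have w0 := Im_ztilde_gt0 ab hb az.
have [z0 _ _ _] := angleP hb az.
rewrite (eq_bigr (fun i : 'I_n => pi^-1 *
    `|Rintegral lmu (Btilde a b (F i)) (kern q (ztilde a b z))|)); last first.
  move=> i _; have [mF Fr] := HF (ltn_ord i).
  by rewrite (Omega_kern q (ltW r0) mF Fr az) normrM ger0_norm ?invr_ge0 ?pi_ge0.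
rewrite -mulr_sumr ler_pdivrMl ?pi_gt0//.
set X := 4 * _ * _.
have X0 : 0 <= X by rewrite !mulr_ge0 ?exprn_ge0 ?powR_ge0.
apply: (@le_trans _ _ X); last first.
  by rewrite ler_peMl// (le_trans _ (pi_ge2 R))// ler1n.
have XE : X = 2 * (r `^ kap) ^+ q / (modz z `^ kap) ^+ q.+1 * (2 * r `^ kap).
  rewrite /X powRN [modz z `^ (_ * _)]powRrM powR_mulrn ?powR_ge0// exprS.
  by ring.
rewrite XE; apply: sum_Rintegral_Btilde; first exact: continuous_kern.
move=> t ht; rewrite -(normc_rotpow a b); apply: kern_far => //.
by rewrite normc_rotpow.
Qed.

(** All cancellation in [z] is given up here: the estimate only helps to build a dominating
    function. The final bound treats the near part after integration. *)
Lemma sum_Omega_near q z : angle a b z ->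
  \sum_(i < n) `|Omega a b q z (F i)| <=
  1 + \sum_(1 <= k < q.+1) modz z `^ (- (kap * k%:R)) * (2 * (r `^ kap) ^+ k).
Proof.
move=> az; have [z0 _ _ _] := angleP hb az.
apply: (@le_trans _ _ (\sum_(i < n) `|poisson_charge z (F i)| +
  \sum_(i < n) \sum_(1 <= k < q.+1) modz z `^ (- (kap * k%:R)) * `|moment k.-1 (F i)|)).
  rewrite -big_split /=; apply: ler_sum => i _; rewrite Omega_poisson_moment.
  apply: le_trans (ler_normD _ _) _; rewrite lerD2l normrM ger0_norm ?invr_ge0 ?pi_ge0//.
  rewrite ler_pdivrMl ?pi_gt0//; set Y := (X in _ <= pi * X).
  have Y0 : 0 <= Y by apply: sumr_ge0 => k _; rewrite mulr_ge0 ?powR_ge0.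
  apply: (@le_trans _ _ Y); last first.
    by rewrite ler_peMl// (le_trans _ (pi_ge2 R))// ler1n.
  apply: le_trans (ler_norm_sum _ _ _) _; apply: ler_sum => k _.
  by rewrite normrM ler_wpM2r// Im_ztildeVX// ler_norm_Im_rotpowV.
apply: lerD; first exact: sum_poisson_charge.
rewrite exchange_big /= big_nat_cond [leRHS]big_nat_cond.
apply: ler_sum => k /andP[/andP[k1 _] _].
rewrite -mulr_sumr ler_wpM2l ?powR_ge0//.
by rewrite -[in leRHS](prednK k1) sum_moment.
Qed.

End Families.

Lemma measurable_poisson_charge B : measurable B ->
  measurable_fun (angle a b) (fun z => poisson_charge z B).
Proof.
move=> mB; apply: measurable_funM => //.
(* The absolute value makes the integrand nonnegative on the whole product, as Tonelli's theorem
   asks; on the angle the imaginary part is positive and nothing changes. *)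
pose f (zt : pt R * R) : \bar R := (\1_(Btilde a b B) zt.2 *
  (`|(ztilde_ext a b zt.1).2| *
   ((zt.2 - (ztilde_ext a b zt.1).1) ^+ 2 + (ztilde_ext a b zt.1).2 ^+ 2)^-1))%:E.
have mX : measurable_fun setT (fun zt : pt R * R => (ztilde_ext a b zt.1).1).
  apply: (measurableT_comp (f := fun z => (ztilde_ext a b z).1)) => //.
  exact: measurable_ztilde_ext1.
have mY : measurable_fun setT (fun zt : pt R * R => (ztilde_ext a b zt.1).2).
  apply: (measurableT_comp (f := fun z => (ztilde_ext a b z).2)) => //.
  exact: measurable_ztilde_ext2.
have mf : measurable_fun setT f.
  apply/measurable_EFinP; apply: measurable_funM.
    apply: (measurableT_comp (f := (\1_(Btilde a b B) : R -> R)) (g := snd)) => //.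
    by apply: measurable_indic; exact: measurable_Btilde.
  apply: measurable_funM; first exact: measurableT_comp.
  apply: measurable_fun_inv; first by move=> zt; rewrite addr_ge0 ?sqr_ge0.
  apply: measurable_funD; last exact: measurable_funX.
  by apply: measurable_funX; apply: measurable_funB.
have f0 zt : (0 <= f zt)%E.
  by rewrite lee_fin mulr_ge0 ?mulr_ge0 ?invr_ge0 ?addr_ge0 ?sqr_ge0.
have := measurable_fun_fubini_tonelli_F (m2 := lmu) f mf f0.
move=> /(measurableT_comp (@fine_measurable R setT measurableT)) h.
apply: eq_measurable_fun (measurable_funTS h) => z; rewrite inE => az /=.
rewrite /Rintegral /fubini_F [in RHS]integral_mkcond; congr fine.
apply: eq_integral => t _; rewrite /f /patch indicE /=.
case: ifPn => tB; last by rewrite mul0r.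
have := Im_ztilde_gt0 ab hb az.
by rewrite mul1r poissonE (ztilde_extE hb az) /= => w0; rewrite gtr0_norm.
Qed.

Lemma measurable_Omega q B : measurable B ->
  measurable_fun (angle a b) (fun z => Omega a b q z B).
Proof.
move=> mB; apply: measurable_funD; first exact: measurable_poisson_charge.
apply: measurable_funM => //; apply: measurable_sum => k.
apply: measurable_funM => //.
apply: eq_measurable_fun (measurable_Im_rotpowV hb (kap * k%:R)) => z.
by rewrite inE => /(angleP hb)[z0 _ _ _]; rewrite Im_ztildeVX.
Qed.

End Boundary.

(** * From the charge to its two variations *)

Section ChargeGrowth.
Variable R : realType.
Implicit Types mu : {measure set (pt R) -> \bar R}.

Lemma measurable_oball (z : pt R) (e : R) : measurable (oball z e).
Proof.
have mf : measurable_fun setT (fun y : pt R => modz (y.1 - z.1, y.2 - z.2)).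
  apply: (measurableT_comp (@measurable_fun_modz R)).
  by apply: measurable_fun_pair; apply: measurable_funB.
rewrite -[X in measurable X]setTI.
have := mf measurableT _ (measurable_itv `]-oo, e[).
by congr measurable; apply/seteqP; split => y /=; rewrite in_itv.
Qed.

Lemma modz_lt_box (x y k : R) : `|x| < k -> `|y| < k -> modz (x, y) < 2 * k.
Proof.
move=> xk yk; have k0 : 0 < k by apply: le_lt_trans xk.
rewrite -(@ltr_pXn2r _ 2%N) ?nnegrE ?modz_ge0//; last by rewrite mulr_ge0// ltW.
rewrite sqr_sqrtr ?addr_ge0 ?sqr_ge0//= -(real_normK (num_real x)) -(real_normK (num_real y)).
have h1 : `|x| ^+ 2 < k ^+ 2 by rewrite ltrXn2r// nnegrE// ltW.
have h2 : `|y| ^+ 2 < k ^+ 2 by rewrite ltrXn2r// nnegrE// ltW.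
rewrite exprMn; have := sqr_ge0 k; lra.
Qed.

(* Lindelof: countably many rational boxes suffice. *)
Lemma locally_null_null mu (U : set (pt R)) : measurable U ->
  (forall z, U z -> exists2 e : R, 0 < e & mu (oball z e) = 0%E) -> mu U = 0%E.
Proof.
move=> mU hU.
pose box (c : rat * rat * rat) : set (pt R) :=
  [set z | `|z.1 - ratr c.1.1| < ratr c.2 /\ `|z.2 - ratr c.1.2| < ratr c.2].
pose G n : set (pt R) := if unpickle n is Some c then
  if `[< mu.-negligible (box c) >] then box c else set0 else set0.
apply: measure_negligible => //.
apply: (negligibleS (mu := mu) (A := \bigcup_n G n)); last first.
  apply: negligible_bigcup => n; rewrite /G.
  case: unpickle => [c|]; last exact: negligible_set0.
  by case: asboolP => // _; exact: negligible_set0.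
move=> z /hU[e e0 ze].
(* Two points of a box of half-side [k] differ by less than [2 * k] in each coordinate, hence by
   less than [4 * k < e] in modulus; so a box containing [z] lies in the null ball. *)
have [k kI] : exists k : rat, ratr k \in `]0, (e / 4)[%R.
  by apply: rat_in_itvoo; rewrite divr_gt0.
move: kI; rewrite in_itv/= => /andP[k0 ke].
have [q1] : exists q : rat, ratr q \in `](z.1 - ratr k), (z.1 + ratr k)[%R.
  by apply: rat_in_itvoo; rewrite ltrD2l gtrN.
have [q2] : exists q : rat, ratr q \in `](z.2 - ratr k), (z.2 + ratr k)[%R.
  by apply: rat_in_itvoo; rewrite ltrD2l gtrN.
rewrite !in_itv/= => /andP[q2a q2b] /andP[q1a q1b].
have [m mE] : exists m : nat, unpickle m = Some (q1, q2, k).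
  by exists (pickle (q1, q2, k)); exact: pickleK.
exists m => //; rewrite /G mE.
have zb : box (q1, q2, k) z.
  by split; rewrite /= ltr_norml; apply/andP; split; lra.
case: asboolP => // -[].
apply: (negligibleS (mu := mu) (A := oball z e)); last first.
  by apply/negligibleP => //; exact: measurable_oball.
move=> y [/= y1 y2]; rewrite /oball /=; case: zb => /= z1 z2.
apply: (@lt_trans _ _ (2 * (2 * ratr k))); last by lra.
apply: modz_lt_box.
  by move: y1 z1; rewrite !ltr_norml => /andP[? ?] /andP[? ?]; apply/andP; split; lra.
by move: y2 z2; rewrite !ltr_norml => /andP[? ?] /andP[? ?]; apply/andP; split; lra.
Qed.

Variables mup mun : {measure set (pt R) -> \bar R}.
Hypothesis Hj : jordan mup mun.

Lemma jordan_fin (A : set (pt R)) r : measurable A -> A `<=` cdisc r ->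
  mup A \is a fin_num /\ mun A \is a fin_num.
Proof.
move=> mA Ar; have [[h1 h2] _] := (Hj.1 r, Hj.2).
by split; rewrite ge0_fin_numE//; [apply: le_lt_trans h1|apply: le_lt_trans h2];
  apply: le_measure; rewrite ?inE//; exact: measurable_cdisc.
Qed.

(* The two pieces of [A] cut by the Hahn set compete in the supremum. *)
Lemma jordan_le_tvar (A : set (pt R)) r : measurable A -> A `<=` cdisc r ->
  (mup A + mun A <= tvar (chg mup mun) A)%E.
Proof.
move=> mA Ar; have [P [mP [mupP munP]]] := Hj.2.
have nullS (mu : {measure set (pt R) -> \bar R}) (E D : set (pt R)) :
    measurable E -> measurable D -> E `<=` D -> mu D = 0%E -> mu E = 0%E.
  move=> mE mD ED D0; apply/eqP; rewrite eq_le measure_ge0 andbT -D0.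
  by apply: le_measure; rewrite ?inE.
have mAP : measurable (A `&` P) by exact: measurableI.
have mAPc : measurable (A `\` P) by exact: measurableD.
have e1 : mup (A `\` P) = 0%E.
  by apply: nullS mupP => //; exact: measurableC.
have e2 : mun (A `&` P) = 0%E by apply: nullS munP => // x [].
have e3 : mup A = mup (A `&` P) by rewrite -[RHS]add0e -[X in _ = (X + _)%E]e1; exact: measureDI.
have e4 : mun A = mun (A `\` P) by rewrite -[RHS]adde0 -[X in _ = (_ + X)%E]e2; exact: measureDI.
have [f1 f2] := jordan_fin mA Ar.
apply: ereal_sup_ubound; exists 2%N, (fun i => if i == 0%N then A `&` P else A `\` P).
split; first by move=> [|i] _ /=; split => // x [].
split.
  move=> [|[|i]] [|[|j]] //= _ _ [x [h1 h2]];
    by case: h1 => _ h1; case: h2 => _ h2.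
rewrite 2!big_ord_recl big_ord0 addr0 /= /chg e1 e2 -e3 -e4 /= subr0 sub0r normrN.
by rewrite !ger0_norm ?fine_ge0// EFinD !fineK.
Qed.

Variables (p r0 : R).
Hypotheses (p0 : 0 <= p) (r00 : 0 < r0).
Hypothesis Hft : finite_type (chg mup mun) p.
Hypothesis Hsupp : odisc r0 `&` csupport (chg mup mun) = set0.

(** A point off the support has a ball of zero variation. Since [mup + mun] is at most the
    variation, both vanish on that ball, and [locally_null_null] glues the balls. *)
Lemma jordan_inner_null : mup (odisc r0) = 0%E /\ mun (odisc r0) = 0%E.
Proof.
have loc z : odisc r0 z -> exists2 e : R, 0 < e &
    mup (oball z e) = 0%E /\ mun (oball z e) = 0%E.
  move=> zr; have : ~ csupport (chg mup mun) z.
    by move=> zs; have : (odisc r0 `&` csupport (chg mup mun)) z by []; rewrite Hsupp.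
  move=> /existsNP[e] /not_implyP[e0] /contrapT tv; exists e => //.
  have Bs : oball z e `<=` cdisc (2 * (modz z + e)).
    move=> y /= ye; apply/ltW.
    have h (x1 x2 : R) : `|x1| <= modz (x1, x2) /\ `|x2| <= modz (x1, x2).
      by split; rewrite -sqrtr_sqr /modz /= ler_sqrt ?addr_ge0 ?sqr_ge0// ?lerDl ?lerDr sqr_ge0.
    have [a1 a2] := h z.1 z.2; have [b1 b2] := h (y.1 - z.1) (y.2 - z.2).
    move: a1 a2; rewrite -surjective_pairing => a1 a2.
    rewrite [y]surjective_pairing; apply: modz_lt_box.
      by rewrite -[y.1](subrK z.1); apply: le_lt_trans (ler_normD _ _) _; rewrite addrC ler_ltD// (le_lt_trans b1).
    by rewrite -[y.2](subrK z.2); apply: le_lt_trans (ler_normD _ _) _; rewrite addrC ler_ltD// (le_lt_trans b2).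
  have := jordan_le_tvar (measurable_oball z e) Bs; rewrite tv => h.
  have h1 := measure_ge0 mup (oball z e); have h2 := measure_ge0 mun (oball z e).
  split; apply/eqP; rewrite eq_le ?h1 ?h2 andbT; apply: le_trans h.
    exact: leeDl.
  exact: leeDr.
split; apply: locally_null_null; try exact: measurable_odisc.
  by move=> z /loc[e e0 []]; exists e.
by move=> z /loc[e e0 []]; exists e.
Qed.

Lemma jordan_growth : exists2 A : R, 0 <= A & forall r : R, 0 < r ->
  (mup (cdisc r) <= (A * r `^ p)%:E)%E /\ (mun (cdisc r) <= (A * r `^ p)%:E)%E.
Proof.
have [C [r1 HC]] := Hft.
have key r : r1 <= r -> (mup (cdisc r) + mun (cdisc r) <= (C * r `^ p)%:E)%E.
  by move=> hr; apply: le_trans (HC r hr); exact: (jordan_le_tvar (measurable_cdisc r) (@subset_refl _ _)).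
pose r2 := Num.max r0 r1.
pose M := fine (mup (cdisc r2) + mun (cdisc r2)).
have [fp fn] := jordan_fin (measurable_cdisc r2) (@subset_refl _ _).
have ME : (mup (cdisc r2) + mun (cdisc r2) = M%:E)%E by rewrite fineK// fin_numD fp.
have M0 : 0 <= M by rewrite fine_ge0// adde_ge0.
have rp0 : 0 < r0 `^ p by rewrite powR_gt0.
(* [|C|] serves the radii beyond [r2], [M / r0^p] those between [r0] and [r2]; below [r0] there is
   no mass. The bound thus holds at every positive radius. *)
pose A := `|C| + M / r0 `^ p.
have A0 : 0 <= A by rewrite addr_ge0// divr_ge0// ltW.
exists A => // r r_gt0.
suff h : (mup (cdisc r) + mun (cdisc r) <= (A * r `^ p)%:E)%E.
  by split; apply: le_trans h; [exact: leeDl|exact: leeDr].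
have [rr0|r0r] := ltP r r0.
  have [n1 n2] := jordan_inner_null.
  have z (mu : {measure set (pt R) -> \bar R}) : mu (odisc r0) = 0%E -> mu (cdisc r) = 0%E.
    move=> h; apply/eqP; rewrite eq_le measure_ge0 andbT -h.
    apply: le_measure; rewrite ?inE; [exact: measurable_cdisc|exact: measurable_odisc|].
    by move=> y /= yr; exact: le_lt_trans rr0.
  by rewrite !z// adde0 lee_fin mulr_ge0 ?powR_ge0.
have rp : r0 `^ p <= r `^ p by rewrite ge0_ler_powR// nnegrE ltW.
have [r2r|rr2] := leP r2 r.
  apply: le_trans (key r _) _; first by rewrite (le_trans _ r2r)// le_max lexx orbT.
  rewrite lee_fin ler_wpM2r ?powR_ge0// /A (le_trans (ler_norm _))// lerDl.
  by rewrite divr_ge0// ltW.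
apply: (@le_trans _ _ M%:E).
  by rewrite -ME leeD// le_measure// ?inE; try exact: measurable_cdisc;
    move=> y /= yr; apply: le_trans (ltW rr2).
rewrite lee_fin /A mulrDl ler_wpDl ?mulr_ge0 ?powR_ge0//.
by rewrite mulrAC ler_pdivlMr// ler_wpM2l.
Qed.

End ChargeGrowth.

(** * Integrability and countable additivity *)

Section SigmaAdditivity.
Context (d : measure_display) (T : measurableType d) (R : realType).
Variable mu : {measure set T -> \bar R}.

Lemma Rintegral_bigcup_cvg (F : nat -> set T) (g : T -> R) :
  trivIset setT F -> (forall k, measurable (F k)) ->
  mu.-integrable (\bigcup_k F k) (EFin \o g) ->
  (\sum_(0 <= k < n) Rintegral mu (F k) g) @[n --> \oo]
    --> Rintegral mu (\bigcup_k F k) g.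
Proof.
move=> tF mF ig.
have mU : measurable (\bigcup_k F k) by exact: bigcupT_measurable.
pose u k := Rintegral mu (F k) g.
(* The real series converges absolutely, its partial sums being bounded by the integral of [|g|];
   this is what lets [fine] commute with the limit. *)
have cu : cvgn (series u).
  apply: normed_cvg; apply: nondecreasing_is_cvgn.
    by apply: nondecreasing_series => n _ _; exact: normr_ge0.
  exists (Rintegral mu (\bigcup_k F k) (fun x => `|g x|)) => _ [n _ <-] /=.
  rewrite /series /= big_mkord; apply: sum_norm_Rintegral_le => //.
    by move=> i _; split => //; exact: bigcup_sup.
  exact: sub_trivIset tF.
suff -> : Rintegral mu (\bigcup_k F k) g = limn (series u) by [].
rewrite /Rintegral (integral_bigcup tF mF ig).
rewrite (_ : (fun n => _) = EFin \o series u); first by rewrite EFin_lim.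
apply/funext => n /=; rewrite /series /= -sumEFin; apply: eq_bigr => i _.
rewrite fineK//; apply: integrable_fin_num => //.
by apply: integrableS ig => //; exact: bigcup_sup.
Qed.

Lemma fine_measure_bigcup_cvg (F : nat -> set T) :
  trivIset setT F -> (forall k, measurable (F k)) ->
  mu (\bigcup_k F k) \is a fin_num ->
  (\sum_(0 <= k < n) fine (mu (F k))) @[n --> \oo] --> fine (mu (\bigcup_k F k)).
Proof.
move=> tF mF fU.
have mU : measurable (\bigcup_k F k) by exact: bigcupT_measurable.
have fF k : mu (F k) \is a fin_num.
  rewrite ge0_fin_numE//; apply: le_lt_trans (_ : (mu (\bigcup_k F k) < +oo)%E).
    by apply: le_measure; rewrite ?inE//; exact: bigcup_sup.
  by rewrite -ge0_fin_numE.
rewrite (_ : (fun n => _) = fine \o (fun n => \sum_(0 <= k < n) mu (F k))%E).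
  have := @measure_semi_sigma_additive _ _ _ mu F mF tF mU.
  by rewrite -(fineK fU) => /fine_cvgP[_].
apply/funext => n /=; rewrite -[LHS]/(fine (_%:E)) -sumEFin; congr fine.
by apply: eq_bigr => k _; rewrite fineK.
Qed.

End SigmaAdditivity.

(** * Integrability and countable additivity of the harmonic charge against one variation *)

Section SingleMeasure.
Variables (R : realType) (a b p r0 A : R) (q : nat).
Variable mu : {measure set (pt R) -> \bar R}.
Hypotheses (ab : a < b) (hb : b <= a + 2 * pi) (p0 : 0 <= p).
Hypotheses (r00 : 0 < r0) (A0 : 0 <= A).
Hypothesis mu_null : mu (odisc r0) = 0%E.
Hypothesis mu_growth : forall r : R, 0 < r -> (mu (cdisc r) <= (A * r `^ p)%:E)%E.
Local Notation kap := (pi / (b - a)).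
Hypothesis pq : p < kap * q.+1%:R.
Local Notation D := (angle a b).
Local Notation D0 := (angle a b `\` odisc r0).

Lemma measurable_angleD (r : R) : measurable (D `\` odisc r).
Proof.
by apply: measurableD; [exact: measurable_angle|exact: measurable_odisc].
Qed.

Lemma integrable_angleD f : measurable_fun D f ->
  mu.-integrable D0 (EFin \o f) -> mu.-integrable D (EFin \o f).
Proof.
move=> mf; apply: (negligible_integrable (measurable_odisc r0) (measurable_angle hb) _ mu_null).2.
exact/measurable_EFinP.
Qed.

Lemma Rintegral_angleD f : mu.-integrable D (EFin \o f) ->
  Rintegral mu D f = Rintegral mu D0 f.
Proof.
move=> intf; congr fine; apply: negligible_integral => //.
- exact: measurable_odisc.
- exact: measurable_angle.
Qed.

(** One majorant for all families in the disc: length one gives integrability, arbitrary length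
    gives domination of partial sums. *)
Lemma Omega_dominated (r : R) : 0 < r -> exists C : R,
  forall (n : nat) (F : nat -> set (pt R)),
  (forall i, (i < n)%N -> measurable (F i) /\ F i `<=` cdisc r) ->
  trivIset [set i | (i < n)%N] F ->
  forall z, D0 z -> \sum_(i < n) `|Omega a b q z (F i)| <=
    C * modz z `^ (- (kap * q.+1%:R)).
Proof.
move=> r_gt0; set rho := r `^ kap.
have rho0 : 0 < rho by exact: powR_gt0.
have k0 := kap_gt0 ab.
(* [M] is the near estimate at its worst, [|z| = r0]. On the near part [|z|^kap < 2 * rho], so the
   factor [(2 * rho) ^+ q.+1] turns it into a multiple of the far power. *)
pose M := 1 + \sum_(1 <= k < q.+1) r0 `^ (- (kap * k%:R)) * (2 * rho ^+ k).
have M0 : 0 <= M.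
  by rewrite addr_ge0// sumr_ge0// => k _; rewrite !mulr_ge0 ?powR_ge0 ?exprn_ge0// ltW.
exists (4 * rho ^+ q.+1 + M * (2 * rho) ^+ q.+1) => n F HF tF z [az /negP].
rewrite -leNgt => rz; have z0 : 0 < modz z := lt_le_trans r00 rz.
rewrite mulrDl; have [far|near] := leP (2 * rho) (modz z `^ kap).
  apply: le_trans (sum_Omega_far ab hb r_gt0 HF tF q az far) _.
  by rewrite lerDl !mulr_ge0 ?powR_ge0// exprn_ge0// mulr_ge0// ltW.
apply: le_trans (sum_Omega_near ab hb r_gt0 HF tF q az) _.
apply: (@le_trans _ _ M).
  rewrite lerD2l; apply: ler_sum => k _; rewrite ler_wpM2r ?mulr_ge0 ?exprn_ge0 ?(ltW rho0)//.
  by rewrite ler_powRN// mulr_ge0// ltW.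
rewrite ler_wpDl ?mulr_ge0 ?powR_ge0 ?exprn_ge0 ?(ltW rho0)//.
rewrite -mulrA ler_peMr// powRN powRrM powR_mulrn ?powR_ge0//.
rewrite ler_pdivlMr ?exprn_gt0 ?powR_gt0// mul1r lerXn2r ?nnegrE ?powR_ge0 ?(ltW near)//.
by rewrite mulr_ge0// ltW.
Qed.

Lemma integrable_dominating (C : R) :
  mu.-integrable D0 (EFin \o (fun z => C * modz z `^ (- (kap * q.+1%:R)))).
Proof.
have mpw (E : set (pt R)) s : measurable_fun E (fun z : pt R => modz z `^ s).
  exact: measurable_modz_powR.
suff h : mu.-integrable D0 (EFin \o (fun z => modz z `^ (- (kap * q.+1%:R)))).
  by have := integrableZl (measurable_angleD r0) C h.
apply/integrableP; split; first exact/measurable_EFinP.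
have [C' _ HC] := growth_integral_tail A0 p0 mu_growth pq.
apply: le_lt_trans (ltry (C' * r0 `^ (p - kap * q.+1%:R))).
apply: le_trans (HC r0 r00).
rewrite (eq_integral (fun z => (modz z `^ (- (kap * q.+1%:R)))%:E)); last first.
  by move=> z _; rewrite gee0_abs// lee_fin powR_ge0.
apply: ge0_subset_integral => //.
- exact: measurable_angleD.
- by apply: measurableC; exact: measurable_odisc.
- exact/measurable_EFinP.
- by move=> z _; rewrite lee_fin powR_ge0.
Qed.

Lemma integrable_Omega (B : set (pt R)) (r : R) : 0 < r -> measurable B ->
  B `<=` cdisc r -> mu.-integrable D (EFin \o (fun z => Omega a b q z B)).
Proof.
move=> r_gt0 mB Br; have mO := measurable_Omega ab hb q mB.
apply: integrable_angleD => //.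
have [C HC] := Omega_dominated r_gt0.
apply: le_integrable (integrable_dominating C) => //.
- exact: measurable_angleD.
- apply/measurable_EFinP; apply: measurable_funS mO; first exact: measurable_angle.
  by move=> z [].
- move=> z D0z; rewrite /= lee_fin.
  have := HC 1%N (fun=> B) _ _ z D0z; rewrite big_ord1 => h.
  apply: le_trans (h _ _) (ler_norm _) => //.
  by move=> [|i] [|j].
Qed.

(** Dominated convergence on the partial sums; pointwise convergence is countable additivity of the
    integral of [kern] over the boundary line. *)
Lemma Rintegral_Omega_bigcup_cvg (B : set (pt R)) (F : nat -> set (pt R)) (r : R) :
  0 < r -> B `<=` cdisc r -> (forall n, measurable (F n)) -> trivIset setT F ->
  \bigcup_n F n = B ->
  (\sum_(0 <= k < n) Rintegral mu D (fun z => Omega a b q z (F k))) @[n --> \oo]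
    --> Rintegral mu D (fun z => Omega a b q z B).
Proof.
move=> r_gt0 Br mF tF FB.
have mB : measurable B by rewrite -FB; exact: bigcupT_measurable.
have Fr k : F k `<=` cdisc r by apply: subset_trans Br; rewrite -FB; exact: bigcup_sup.
have [C HC] := Omega_dominated r_gt0.
have iF k := integrable_Omega r_gt0 (mF k) (@Fr k).
have iB := integrable_Omega r_gt0 mB Br.
have mD := measurable_angle hb.
have mD0 := measurable_angleD r0.
have iF0 k : mu.-integrable D0 (EFin \o (fun z => Omega a b q z (F k))).
  by apply: integrableS (iF k) => // z [].
have iB0 : mu.-integrable D0 (EFin \o (fun z => Omega a b q z B)).
  by apply: integrableS iB => // z [].
pose f_ n z := (\sum_(0 <= k < n) Omega a b q z (F k))%:E.
have mf n : measurable_fun D0 (f_ n).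
  apply/measurable_EFinP; apply: measurable_sum => k.
  by have /integrableP[/measurable_EFinP] := iF0 k.
have ptw z : D0 z -> f_ n z @[n --> \oo] --> (Omega a b q z B)%:E.
  move=> [az _]; apply: cvg_EFin; first exact: nearW.
  have w0 := Im_ztilde_gt0 ab hb az.
  have E : (fun n => \sum_(0 <= k < n) Omega a b q z (F k)) =
      (fun n => pi^-1 * \sum_(0 <= k < n)
     Rintegral lebesgue_measure (Btilde a b (F k)) (kern q (ztilde a b z))).
    apply/funext => n /=; rewrite mulr_sumr; apply: eq_bigr => k _.
    exact: (Omega_kern ab hb q (ltW r_gt0) (mF k) (@Fr k) az).
  suff : (fun n => \sum_(0 <= k < n) Omega a b q z (F k)) n @[n --> \oo]
      --> Omega a b q z B by [].
  rewrite E (Omega_kern ab hb q (ltW r_gt0) mB Br az).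
  apply: cvgM; first exact: cvg_cst.
  rewrite -FB Btilde_bigcup//; apply: Rintegral_bigcup_cvg.
  - exact: Btilde_trivIset.
  - by move=> k; exact: measurable_Btilde.
  - rewrite -Btilde_bigcup// FB.
    exact (integrable_Btilde ab (ltW r_gt0) mB Br (continuous_kern w0 (q:=q))).
have mOB : measurable_fun D0 (fun z => (Omega a b q z B)%:E).
  by case/integrableP : iB0.
have dom : \forall z \ae mu, forall n, D0 z ->
    (`|f_ n z| <= (C * modz z `^ (- (kap * q.+1%:R)))%:E)%E.
  apply: aeW => z n D0z; rewrite /f_ /= lee_fin.
  apply: le_trans (ler_norm_sum _ _ _) _; rewrite big_mkord; apply: HC => //.
  exact: sub_trivIset tF.
have [_ _] := dominated_convergence mD0 mf mOB (aeW mu ptw) (integrable_dominating C) dom.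
rewrite -(fineK (integrable_fin_num mD0 iB0)) => /fine_cvgP[_].
rewrite -/(Rintegral mu D0 (fun z => Omega a b q z B)) -Rintegral_angleD//.
suff -> : (fun n => \sum_(0 <= k < n) Rintegral mu D (fun z => Omega a b q z (F k))) =
  fine \o (fun n => \int[mu]_(x in D0) f_ n x)%E by [].
apply/funext => n /=.
rewrite (_ : \int[mu]_(x in D0) f_ n x = (\sum_(0 <= k < n)
  \int[mu]_(z in D0) (Omega a b q z (F k))%:E))%E; last first.
  by rewrite /f_; under eq_integral do rewrite -sumEFin; rewrite integral_sum.
rewrite -[LHS]/(fine (_%:E)) -sumEFin; congr fine; apply: eq_bigr => k _.
by rewrite Rintegral_angleD// /Rintegral fineK//; exact (integrable_fin_num mD0 (iF0 k)).
Qed.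

End SingleMeasure.

(** * Near and far parts of the angle *)

Section FunctionFamilies.
Context (d : measure_display) (T : measurableType d) (R : realType).
Variable mu : {measure set T -> \bar R}.

(** The induction removes the last function together with its share [|f n|] of the majorant, which
    is why [g] must stay general. *)
Lemma sum_norm_Rintegral_fun_le (D : set T) (n : nat) (f : nat -> T -> R) (g : T -> R) :
  measurable D -> (forall i, (i < n)%N -> mu.-integrable D (EFin \o f i)) ->
  mu.-integrable D (EFin \o g) ->
  (forall x, D x -> \sum_(i < n) `|f i x| <= g x) ->
  \sum_(i < n) `|Rintegral mu D (f i)| <= Rintegral mu D g.
Proof.
move=> mD.
elim: n g => [|n IH] g fi gi fg.
  by rewrite big_ord0; apply: Rintegral_ge0 => x /fg; rewrite big_ord0.
have fni : mu.-integrable D (EFin \o (fun x => `|f n x|)).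
  by have := integrable_norm (fi n (ltnSn n)).
have gfi : mu.-integrable D (EFin \o (fun x => g x - `|f n x|)).
  by have := integrableB mD gi fni.
rewrite big_ord_recr /= -lerBrDr.
apply: (@le_trans _ _ (Rintegral mu D (fun x => g x - `|f n x|))).
  apply: IH => //; first by move=> i ni; apply: fi; exact: ltnW.
  by move=> x /fg; rewrite big_ord_recr /= -lerBrDr.
rewrite RintegralB// lerD2l lerN2.
by apply: le_normr_Rintegral => //; exact: fi.
Qed.

Lemma bounded_integrable (D : set T) (f : T -> R) (M : R) : measurable D ->
  (mu D < +oo)%E -> measurable_fun D f -> (forall x, D x -> `|f x| <= M) ->
  mu.-integrable D (EFin \o f).
Proof.
move=> mD Doo mf fM; apply/integrableP; split; first exact/measurable_EFinP.
apply: le_lt_trans (_ : (\int[mu]_(x in D) cst `|M|%:E x < +oo)%E).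
  apply: ge0_le_integral => //.
  - by apply: measurableT_comp => //; exact/measurable_EFinP.
  - by move=> x Dx; rewrite lee_fin (le_trans (fM x Dx))// ler_norm.
by rewrite integral_cst// lte_mul_pinfty.
Qed.

(** Integrability and value go through one induction, since additivity of the integral needs
    integrability of the remaining sum. *)
Lemma Rintegral_linear_sum (D : set T) (s : seq nat) (c : nat -> R) (f : nat -> T -> R) :
  measurable D -> (forall k, mu.-integrable D (EFin \o f k)) ->
  mu.-integrable D (EFin \o (fun x => \sum_(k <- s) f k x * c k)) /\
  Rintegral mu D (fun x => \sum_(k <- s) f k x * c k) =
  \sum_(k <- s) Rintegral mu D (f k) * c k.
Proof.
move=> mD fi; elim: s => [|k s [IHi IHE]].
  rewrite (_ : (fun _ => _) = cst 0); last by apply/funext => x; rewrite big_nil.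
  rewrite big_nil; split; first exact: integrable0.
  by rewrite Rintegral_cst// mul0r.
have fci : mu.-integrable D (EFin \o (fun x => f k x * c k)).
  by have := integrableZr mD (c k) (fi k).
have E : (fun x => \sum_(k <- k :: s) f k x * c k) =
    (fun x => f k x * c k + \sum_(k <- s) f k x * c k).
  by apply/funext => x; rewrite big_cons.
rewrite E; split; first by have := integrableD mD fci IHi.
by rewrite RintegralD// RintegralZr// IHE big_cons.
Qed.

Lemma ler_norm_fine (x : \bar R) (c : R) : (`|x| <= c%:E)%E -> `|fine x| <= c.
Proof. by case: x => [r| |] //=; rewrite ?leye_eq ?lee_fin. Qed.

End FunctionFamilies.

Section NearFar.
Variables (R : realType) (a b p r0 A : R) (q : nat).
Hypotheses (ab : a < b) (hb : b <= a + 2 * pi) (p0 : 0 <= p).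
Hypotheses (r00 : 0 < r0) (A0 : 0 <= A).
Local Notation kap := (pi / (b - a)).
Hypothesis pq : p < kap * q.+1%:R.
Local Notation D := (angle a b).
Local Notation D0 := (angle a b `\` odisc r0).
Local Notation e s := (fun z => complex.Im ((rotpow a b s z)^-1)%C).

(* [|ztilde z| = 2 * r `^ kap] on the circle of radius [cut * r]. *)
Definition cut : R := 2 `^ kap^-1.

Lemma cut_ge1 : 1 <= cut.
Proof. by rewrite -(powRr0 2) ler_powR ?ler1n// invr_ge0 ltW// kap_gt0. Qed.

Lemma cut_gt0 : 0 < cut.
Proof. exact: lt_le_trans cut_ge1. Qed.

Lemma cut_powR (r : R) : 0 < r -> (cut * r) `^ kap = 2 * r `^ kap.
Proof.
move=> r_gt0; rewrite powRM ?(ltW r_gt0) ?(ltW cut_gt0)//.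
by rewrite /cut -powRrM mulVf ?powRr1// gt_eqF// kap_gt0.
Qed.

(** Leaving out the massless disc of radius [r0] keeps the negative powers of [|z|] bounded, hence
    integrable on this set. *)
Definition near (r : R) := D0 `&` odisc (cut * r).
Definition far (r : R) := D0 `\` odisc (cut * r).

Lemma measurable_near r : measurable (near r).
Proof. by apply: measurableI; [exact: measurable_angleD|exact: measurable_odisc]. Qed.

Lemma measurable_far r : measurable (far r).
Proof. by apply: measurableD; [exact: measurable_angleD|exact: measurable_odisc]. Qed.

Section OneMeasure.
Variable mu : {measure set (pt R) -> \bar R}.
Hypothesis mu_null : mu (odisc r0) = 0%E.
Hypothesis mu_growth : forall r : R, 0 < r -> (mu (cdisc r) <= (A * r `^ p)%:E)%E.

Lemma norm_Rintegral_rotpowV_le (E S : set (pt R)) (s c : R) :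
  measurable E -> measurable S -> E `<=` D -> E `<=` S ->
  (\int[mu]_(z in S) (modz z `^ (- s))%:E <= c%:E)%E ->
  `|Rintegral mu E (e s)| <= c.
Proof.
move=> mE mS ED ES Sc; apply: ler_norm_fine; apply: le_trans Sc.
have me : measurable_fun E (fun z => (e s z)%:E).
  apply/measurable_EFinP; apply: measurable_funS (measurable_Im_rotpowV hb s) => //.
  exact: measurable_angle.
apply: le_trans (le_abse_integral mu mE me) _.
apply: (@le_trans _ _ (\int[mu]_(z in E) (modz z `^ (- s))%:E)%E).
  apply: ge0_le_integral => //.
  - exact: measurableT_comp.
  - by apply/measurable_EFinP; exact: measurable_modz_powR.
  - move=> z /ED /(angleP hb)[z0 _ _ _].
    by rewrite /= lee_fin ler_norm_Im_rotpowV.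
apply: ge0_subset_integral => //.
- by apply/measurable_EFinP; exact: measurable_modz_powR.
- by move=> z _; rewrite lee_fin powR_ge0.
Qed.

Lemma near_measure_le r : 0 < r -> (mu (near r) <= (A * (cut * r) `^ p)%:E)%E.
Proof.
move=> r_gt0; have x0 : 0 < cut * r by rewrite mulr_gt0// cut_gt0.
apply: le_trans (mu_growth x0); apply: le_measure; rewrite ?inE.
- exact: measurable_near.
- exact: measurable_cdisc.
- by move=> z [_ /= /ltW].
Qed.

Lemma near_fin r : 0 < r -> (mu (near r) < +oo)%E.
Proof. by move=> r_gt0; apply: le_lt_trans (near_measure_le r_gt0) (ltry _). Qed.

Lemma integrable_near_rotpowV r s : 0 < r -> 0 <= s ->
  mu.-integrable (near r) (EFin \o e s).
Proof.
move=> r_gt0 s0; apply: (bounded_integrable (M := r0 `^ (- s))).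
- exact: measurable_near.
- exact: near_fin.
- apply: measurable_funS (measurable_Im_rotpowV hb s); first exact: measurable_angle.
  by move=> z [[]].
- move=> z [[az /negP]]; rewrite -leNgt => rz _.
  have [z0 _ _ _] := angleP hb az.
  by apply: le_trans (ler_norm_Im_rotpowV _ _ _ z0) _; rewrite ler_powRN.
Qed.

Section Families.
Variables (r : R) (n : nat) (F : nat -> set (pt R)).
Hypotheses (r_gt0 : 0 < r)
  (HF : forall i, (i < n)%N -> measurable (F i) /\ F i `<=` cdisc r)
  (tF : trivIset [set i | (i < n)%N] F).

Lemma integrable_near_poisson i : (i < n)%N ->
  mu.-integrable (near r) (EFin \o (fun z => poisson_charge a b z (F i))).
Proof.
move=> ni; have [mF Fr] := HF ni; apply: (bounded_integrable (M := 1)).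
- exact: measurable_near.
- exact: near_fin.
- apply: measurable_funS (measurable_poisson_charge ab hb mF); first exact: measurable_angle.
  by move=> z [[]].
- move=> z [[az _] _]; apply: le_trans (sum_poisson_charge ab hb r_gt0 HF tF az).
  by rewrite (bigD1 (Ordinal ni))//= lerDl sumr_ge0.
Qed.

Lemma sum_near_poisson :
  \sum_(i < n) `|Rintegral mu (near r) (fun z => poisson_charge a b z (F i))| <=
  A * (cut * r) `^ p.
Proof.
have fN := near_fin r_gt0.
apply: (@le_trans _ _ (Rintegral mu (near r) (fun=> 1))).
  apply: (@sum_norm_Rintegral_fun_le _ _ _ mu (near r) n
    (fun i z => poisson_charge a b z (F i))).
  - exact: measurable_near.
  - by move=> i ni; exact: integrable_near_poisson.
  - apply: (bounded_integrable (M := 1)) => //; first exact: measurable_near.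
    by move=> z _; rewrite normr1.
  - by move=> z [[az _] _]; exact: (sum_poisson_charge ab hb r_gt0 HF tF az).
rewrite Rintegral_cst ?mul1r; last exact: measurable_near.
rewrite -lee_fin fineK; first exact: near_measure_le.
by rewrite ge0_fin_numE.
Qed.

(** The variables separate in the correction terms. The integrals in [z] keep their sign, ready to
    be subtracted between [mup] and [mun]. *)
Lemma near_Omega_split i : (i < n)%N ->
  Rintegral mu (near r) (fun z => Omega a b q z (F i)) =
  Rintegral mu (near r) (fun z => poisson_charge a b z (F i)) +
  \sum_(1 <= k < q.+1) Rintegral mu (near r) (e (kap * k%:R)) * (pi^-1 * moment a b k.-1 (F i)).
Proof.
move=> ni; have mN := measurable_near r.
have ie k : mu.-integrable (near r) (EFin \o e (kap * k%:R)).
  by apply: integrable_near_rotpowV => //; rewrite mulr_ge0// ltW// kap_gt0.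
have [isum sE] := Rintegral_linear_sum (index_iota 1 q.+1)
  (fun k => pi^-1 * moment a b k.-1 (F i)) mN ie.
rewrite -sE -RintegralD//; last exact: integrable_near_poisson.
apply: eq_Rintegral => z; rewrite inE => -[[az _] _].
have [z0 _ _ _] := angleP hb az.
rewrite Omega_poisson_moment mulr_sumr; congr (_ + _); apply: eq_bigr => k _.
by rewrite Im_ztildeVX//; ring.
Qed.

(** With [s = kap * (q + 1)], the boundary interval contributes [r^s] and the tail integral
    [r^(p - s)], which multiply to [r^p]. *)
Lemma sum_far_Omega (C : R) : (forall x : R, 0 < x ->
    (\int[mu]_(z in ~` odisc x) (modz z `^ (- (kap * q.+1%:R)))%:E <=
      (C * x `^ (p - kap * q.+1%:R))%:E)%E) ->
  \sum_(i < n) `|Rintegral mu (far r) (fun z => Omega a b q z (F i))| <=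
  4 * C * cut `^ (p - kap * q.+1%:R) * r `^ p.
Proof.
move=> HC; set s := kap * q.+1%:R.
have FD : far r `<=` D0 by move=> z [].
have idom := integrable_dominating hb p0 r00 A0 mu_growth pq (4 * (r `^ kap) ^+ q.+1).
have mF := measurable_far r.
apply: (@le_trans _ _ (Rintegral mu (far r)
    (fun z => 4 * (r `^ kap) ^+ q.+1 * modz z `^ (- s)))).
  apply: (@sum_norm_Rintegral_fun_le _ _ _ mu (far r) n (fun i z => Omega a b q z (F i))) => //.
  - move=> i ni; have [mFi Fr] := HF ni.
    apply: integrableS (integrable_Omega ab hb p0 r00 A0 mu_null mu_growth pq r_gt0 mFi Fr) => //.
      exact: measurable_angle.
    by move=> z [[]].
  - by apply: integrableS idom => //; exact: measurable_angleD.
  - move=> z [[az _] /negP]; rewrite -leNgt => zr.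
    apply: (sum_Omega_far ab hb r_gt0 HF tF q az).
    have [z0 _ _ _] := angleP hb az.
    rewrite -cut_powR// ge0_ler_powR ?nnegrE ?(ltW z0)//.
      by rewrite ltW// kap_gt0.
    by rewrite mulr_ge0// ltW// cut_gt0.
rewrite RintegralZl//; last first.
  have := integrable_dominating hb p0 r00 A0 mu_growth pq 1.
  rewrite (_ : (fun _ => _) = (fun z => modz z `^ (- s))); last first.
    by apply/funext => z; rewrite mul1r.
  by apply: integrableS => //; exact: measurable_angleD.
have x0 : 0 < cut * r by rewrite mulr_gt0// cut_gt0.
have h : Rintegral mu (far r) (fun z => modz z `^ (- s)) <= C * (cut * r) `^ (p - s).
  apply: le_trans (ler_norm _) _; apply: ler_norm_fine.
  apply: le_trans (HC _ x0); rewrite gee0_abs; last first.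
    by apply: integral_ge0 => z _; rewrite lee_fin powR_ge0.
  apply: ge0_subset_integral => //.
  - by apply: measurableC; exact: measurable_odisc.
  - by apply/measurable_EFinP; exact: measurable_modz_powR.
  - by move=> z _; rewrite lee_fin powR_ge0.
  - by move=> z [].
apply: le_trans (ler_wpM2l _ h) _; first by rewrite mulr_ge0// exprn_ge0// powR_ge0.
rewrite powRM ?(ltW r_gt0) ?(ltW cut_gt0)//.
rewrite -powR_mulrn ?powR_ge0// -powRrM -/s.
have -> : r `^ p = r `^ s * r `^ (p - s) by rewrite powR_pos_add// addrC subrK.
by rewrite le_eqVlt; apply/orP; left; apply/eqP; ring.
Qed.

End Families.
End OneMeasure.
End NearFar.

(** * Bounds for the balayage *)

Section Balayage.
Variables (R : realType) (a b p r0 A : R) (q : nat).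
Variables mup mun : {measure set (pt R) -> \bar R}.
Hypotheses (ab : a < b) (hb : b <= a + 2 * pi) (p0 : 0 <= p).
Hypotheses (r00 : 0 < r0) (A0 : 0 <= A) (Hj : jordan mup mun).
Hypotheses (nullp : mup (odisc r0) = 0%E) (nulln : mun (odisc r0) = 0%E).
Hypothesis growthp : forall r : R, 0 < r -> (mup (cdisc r) <= (A * r `^ p)%:E)%E.
Hypothesis growthn : forall r : R, 0 < r -> (mun (cdisc r) <= (A * r `^ p)%:E)%E.
Local Notation kap := (pi / (b - a)).
Hypotheses (qp : kap * q%:R <= p) (pq : p < kap * q.+1%:R).
Local Notation D := (angle a b).
Local Notation D0 := (angle a b `\` odisc r0).
Local Notation e s := (fun z => complex.Im ((rotpow a b s z)^-1)%C).
Local Notation near := (near a b r0).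
Local Notation far := (far a b r0).
Local Notation cut := (cut a b).
Local Notation bl := (blaschke_int a b (kap * q%:R) r0 mup mun).
Local Notation bal := (balayage a b q mup mun).

Lemma balayage_exists_of_growth : balayage_exists a b q mup mun.
Proof.
have Hr (B : set (pt R)) : bounded_borel B -> measurable B /\ exists2 r : R, 0 < r & B `<=` cdisc r.
  move=> [mB [r Br]]; split=> //; exists (Num.max r 1); first by rewrite lt_max ltr01 orbT.
  by move=> z /Br /= zr; rewrite /cdisc /= le_max zr.
split=> [B /Hr[mB [r r_gt0 Br]]|B F /Hr[mB [r r_gt0 Br]] mF tF FB].
  split; first exact: (integrable_Omega ab hb p0 r00 A0 nullp growthp pq r_gt0 mB Br).
  exact: (integrable_Omega ab hb p0 r00 A0 nulln growthn pq r_gt0 mB Br).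
have cp := Rintegral_Omega_bigcup_cvg ab hb p0 r00 A0 nullp growthp pq r_gt0 Br mF tF FB.
have cn := Rintegral_Omega_bigcup_cvg ab hb p0 r00 A0 nulln growthn pq r_gt0 Br mF tF FB.
have mFD k : measurable (F k `\` D) by apply: measurableD => //; exact: measurable_angle.
have tFD : trivIset setT (fun k => F k `\` D).
  by move=> i j _ _ [z [[Fi _] [Fj _]]]; apply: tF => //; exists z.
have UE : \bigcup_k (F k `\` D) = B `\` D by rewrite -FB setDE setI_bigcupl.
have [fp fn] := jordan_fin Hj (measurableD mB (measurable_angle hb)) (subset_trans (@subDsetl _ _ _) Br).
have dp := @fine_measure_bigcup_cvg _ _ _ mup _ tFD mFD.
have dn := @fine_measure_bigcup_cvg _ _ _ mun _ tFD mFD.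
rewrite UE in dp dn.
have H := cvgD (cvgB cp cn) (cvgB (dp fp) (dn fn)).
rewrite (_ : (fun n => _) = (fun n =>
    \sum_(0 <= k < n) Rintegral mup D (fun z => Omega a b q z (F k)) -
    \sum_(0 <= k < n) Rintegral mun D (fun z => Omega a b q z (F k)) +
    (\sum_(0 <= k < n) fine (mup (F k `\` D)) - \sum_(0 <= k < n) fine (mun (F k `\` D)))));
  first exact: H.
by apply/funext => n; rewrite -!sumrB -big_split.
Qed.

Lemma nu_int_near_bound (k : nat) : (k <= q)%N -> exists2 C : R, 0 <= C &
  forall r : R, 0 < r ->
    (r `^ kap) ^+ k * `|nu_int mup mun (near r) (e (kap * k%:R))| <=
    C * (r `^ p + r `^ (kap * q%:R) * `|bl r|).
Proof.
have k0 := kap_gt0 ab; have c0 := cut_gt0 ab.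
have powE r m : (r `^ kap) ^+ m = r `^ (kap * m%:R).
  by rewrite -powR_mulrn ?powR_ge0// -powRrM.
rewrite leq_eqVlt => /orP[/eqP ->|kq].
  (* The 1 carries the Blaschke integral; [2 * A * cut^p] bounds the two variations on the annulus
     from [r] to [cut * r], which separates the near part from the Blaschke domain. *)
  exists (1 + 2 * A * cut `^ p) => [|r r_gt0].
    by rewrite addr_ge0// !mulr_ge0// powR_ge0.
  have x0 : 0 < cut * r by rewrite mulr_gt0.
  pose N1 : set (pt R) := (odisc r `\` odisc r0) `&` D.
  pose N2 := near r `\` odisc r.
  have mN1 : measurable N1.
    apply: measurableI; last exact: measurable_angle.
    by apply: measurableD; exact: measurable_odisc.
  have mN2 : measurable N2.
    by apply: measurableD; [exact: measurable_near|exact: measurable_odisc].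
  have NE : near r = N1 `|` N2.
    apply/seteqP; split=> z.
      move=> [[az zr0] zr]; have [h|h] := pselect (odisc r z); [left|right]; split => //.
    move=> [[[zr zr0] az]|[]//]; split => //.
    by rewrite /odisc /= (lt_le_trans zr)// ler_peMl ?(ltW r_gt0)// cut_ge1.
  have dN : [disjoint N1 & N2].
    by apply/disj_setPS => z [[[zr _] _] [_]].
  have split_int (mu : {measure set (pt R) -> \bar R}) : mu (odisc r0) = 0%E ->
      (forall r : R, 0 < r -> (mu (cdisc r) <= (A * r `^ p)%:E)%E) ->
      Rintegral mu (near r) (e (kap * q%:R)) =
      Rintegral mu N1 (e (kap * q%:R)) + Rintegral mu N2 (e (kap * q%:R)) /\
      `|Rintegral mu N2 (e (kap * q%:R))| <= r `^ (- (kap * q%:R)) * (A * (cut * r) `^ p).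
    move=> nullmu growthmu; split.
      rewrite NE Rintegral_setU// -NE.
      by apply: (integrable_near_rotpowV ab hb r00 growthmu) => //; rewrite mulr_ge0// ltW.
    apply: (norm_Rintegral_rotpowV_le hb mN2 mN2) => //; first by move=> z [[[]]].
    apply: (growth_integral_annulus growthmu) => //; first by rewrite mulr_ge0// ltW.
    by move=> z [[_ zr] /negP]; rewrite -leNgt => rz; rewrite rz ltW.
  have [Ep Bp] := split_int _ nullp growthp.
  have [En Bn] := split_int _ nulln growthn.
  rewrite /nu_int Ep En.
  set u := Rintegral mup N2 _ in Bp *; set v := Rintegral mun N2 _ in Bn *.
  set c := r `^ (- _) * _ in Bp Bn.
  have -> : Rintegral mup N1 (e (kap * q%:R)) + u - (Rintegral mun N1 (e (kap * q%:R)) + v) =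
      bl r + (u - v) by rewrite opprD addrACA.
  set Y := r `^ p + _.
  have Z0 : 0 < r `^ (kap * q%:R) by exact: powR_gt0.
  rewrite powE; apply: (@le_trans _ _ (r `^ (kap * q%:R) * `|bl r| + r `^ (kap * q%:R) * (2 * c))).
    rewrite -mulrDr ler_wpM2l ?(ltW Z0)//; apply: le_trans (ler_normD _ _) _.
    rewrite lerD2l; apply: le_trans (ler_normB _ _) _; lra.
  have -> : r `^ (kap * q%:R) * (2 * c) = 2 * A * cut `^ p * r `^ p.
    by rewrite /c powRN powRM ?(ltW r_gt0) ?(ltW c0)//; field; rewrite gt_eqF.
  rewrite [leRHS]mulrDl mul1r; apply: lerD; first by rewrite /Y lerDr powR_ge0.
  rewrite ler_wpM2l ?mulr_ge0 ?powR_ge0// /Y lerDl mulr_ge0 ?powR_ge0//.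
(* Below the top index the exponent is strictly subcritical, so the head integrals may be bounded
   with absolute values. *)
have kp : kap * k%:R < p.
  by apply: lt_le_trans qp; rewrite ltr_pM2l// ltr_nat.
have kk0 : 0 <= kap * k%:R by rewrite mulr_ge0// ltW.
have [Cp Cp0 HCp] := growth_integral_head A0 r00 nullp growthp kk0 kp.
have [Cn Cn0 HCn] := growth_integral_head A0 r00 nulln growthn kk0 kp.
exists ((Cp + Cn) * cut `^ (p - kap * k%:R)) => [|r r_gt0].
  by rewrite mulr_ge0 ?addr_ge0 ?powR_ge0.
have x0 : 0 < cut * r by rewrite mulr_gt0.
have nE : near r `<=` D by move=> z [[]].
have nS : near r `<=` odisc (cut * r) by move=> z [].
have mN := measurable_near r0 hb r.
have Bp := norm_Rintegral_rotpowV_le hb mN (measurable_odisc _) nE nS (HCp _ x0).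
have Bn := norm_Rintegral_rotpowV_le hb mN (measurable_odisc _) nE nS (HCn _ x0).
rewrite powE; apply: (@le_trans _ _ (r `^ (kap * k%:R) *
    ((Cp + Cn) * (cut * r) `^ (p - kap * k%:R)))).
  rewrite ler_wpM2l ?powR_ge0// /nu_int; apply: le_trans (ler_normB _ _) _; lra.
rewrite powRM ?(ltW r_gt0) ?(ltW c0)//.
apply: (@le_trans _ _ ((Cp + Cn) * cut `^ (p - kap * k%:R) * r `^ p)).
  have -> : r `^ p = r `^ (kap * k%:R) * r `^ (p - kap * k%:R).
    by rewrite powR_pos_add// addrC subrK.
  by rewrite le_eqVlt; apply/orP; left; apply/eqP; ring.
rewrite ler_wpM2l ?mulr_ge0 ?addr_ge0 ?powR_ge0// lerDl mulr_ge0 ?powR_ge0//.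
Qed.

Lemma sum_nu_int_near_bound (m : nat) : (m <= q)%N -> exists2 C : R, 0 <= C &
  forall r : R, 0 < r ->
    \sum_(1 <= k < m.+1) `|nu_int mup mun (near r) (e (kap * k%:R))| * (2 * (r `^ kap) ^+ k)
    <= C * (r `^ p + r `^ (kap * q%:R) * `|bl r|).
Proof.
elim: m => [|m IH] mq.
  exists 0 => // r _; rewrite big_geq// mul0r//.
have [C C0 HC] := IH (ltnW mq).
have [C' C'0 HC'] := nu_int_near_bound mq.
exists (C + 2 * C') => [|r r_gt0]; first by rewrite addr_ge0// mulr_ge0.
rewrite big_nat_recr//= [leRHS]mulrDl; apply: lerD; first exact: HC.
rewrite mulrCA -[leRHS]mulrA ler_pM2l// mulrC; exact: HC'.
Qed.

Lemma nu_int_Omega_split (r : R) (n : nat) (F : nat -> set (pt R)) : 0 < r ->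
  (forall i, (i < n)%N -> measurable (F i) /\ F i `<=` cdisc r) ->
  trivIset [set i | (i < n)%N] F ->
  forall i, (i < n)%N ->
  nu_int mup mun D (fun z => Omega a b q z (F i)) =
  nu_int mup mun (near r) (fun z => poisson_charge a b z (F i)) +
  \sum_(1 <= k < q.+1) nu_int mup mun (near r) (e (kap * k%:R)) *
     (pi^-1 * moment a b k.-1 (F i)) +
  nu_int mup mun (far r) (fun z => Omega a b q z (F i)).
Proof.
move=> r_gt0 HF tF i ni; have [mF Fr] := HF i ni.
have mD := measurable_angle hb.
have key (mu : {measure set (pt R) -> \bar R}) : mu (odisc r0) = 0%E ->
    (forall r : R, 0 < r -> (mu (cdisc r) <= (A * r `^ p)%:E)%E) ->
  Rintegral mu D (fun z => Omega a b q z (F i)) =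
  Rintegral mu (near r) (fun z => poisson_charge a b z (F i)) +
  \sum_(1 <= k < q.+1) Rintegral mu (near r) (e (kap * k%:R)) *
     (pi^-1 * moment a b k.-1 (F i)) +
  Rintegral mu (far r) (fun z => Omega a b q z (F i)).
  move=> nullmu growthmu.
  have iO := integrable_Omega ab hb p0 r00 A0 nullmu growthmu pq r_gt0 mF Fr.
  rewrite (Rintegral_angleD hb nullmu iO).
  rewrite -(near_Omega_split q ab hb r00 growthmu r_gt0 HF tF ni).
  have E : D0 = near r `|` far r.
    by rewrite /near /far setDE -setIUr setUv setIT.
  rewrite {1}E Rintegral_setU//.
  - exact: measurable_near.
  - exact: measurable_far.
  - by rewrite -E; apply: integrableS iO => //; exact: measurable_angleD.
  - by apply/disj_setPS => z [[_ h] [_]].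
rewrite /nu_int (key _ nullp growthp) (key _ nulln growthn).
under [X in _ = _ + X + _]eq_bigr do rewrite mulrBl.
rewrite sumrB; ring.
Qed.

(** Masses are integrals of 1, so [sum_norm_Rintegral_le] applies to each variation; the factor 2
    counts the two of them. *)
Lemma sum_chg_le (E : set (pt R)) (r : R) (n : nat) (F : nat -> set (pt R)) : 0 < r ->
  measurable E ->
  (forall i, (i < n)%N -> measurable (F i) /\ F i `<=` cdisc r) ->
  trivIset [set i | (i < n)%N] F ->
  \sum_(i < n) `|chg mup mun (F i `&` E)| <= 2 * A * r `^ p.
Proof.
move=> r_gt0 mE HF tF.
have key (mu : {measure set (pt R) -> \bar R}) :
    (forall r : R, 0 < r -> (mu (cdisc r) <= (A * r `^ p)%:E)%E) ->
    \sum_(i < n) fine (mu (F i `&` E)) <= A * r `^ p.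
  move=> growthmu.
  have rfin (B : set (pt R)) : measurable B -> B `<=` cdisc r -> mu B \is a fin_num.
    move=> mB Br; rewrite ge0_fin_numE//; apply: le_lt_trans (ltry (A * r `^ p)).
    apply: le_trans (growthmu r r_gt0); apply: le_measure; rewrite ?inE//.
    exact: measurable_cdisc.
  have h := @sum_norm_Rintegral_le _ _ R mu (cdisc r) n (fun i => F i `&` E) (fun=> 1)
    (measurable_cdisc r).
  apply: le_trans (_ : Rintegral mu (cdisc r) (fun=> `|1|) <= _).
    apply: le_trans (h _ _ _).
    - apply: ler_sum => i _; have [mFi Fr] := HF i (ltn_ord i).
      rewrite Rintegral_cst ?mul1r ?ler_norm//; exact: measurableI.
    - move=> i ni; have [mFi Fr] := HF i ni; split; first exact: measurableI.
      by move=> z [/Fr].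
    - by move=> i j ni nj [z [[Fi _] [Fj _]]]; apply: tF => //; exists z.
    - apply: (bounded_integrable (M := 1)) => //; first exact: measurable_cdisc.
        by apply: le_lt_trans (growthmu r r_gt0) (ltry _).
      by move=> z _; rewrite normr1.
  rewrite Rintegral_cst; last exact: measurable_cdisc.
  rewrite normr1 mul1r -lee_fin fineK; first exact: growthmu.
  by apply: rfin; [exact: measurable_cdisc|].
apply: (@le_trans _ _ (\sum_(i < n) fine (mup (F i `&` E)) + \sum_(i < n) fine (mun (F i `&` E)))).
  rewrite -big_split /=; apply: ler_sum => i _.
  apply: le_trans (ler_normB _ _) _.
  by rewrite !ger0_norm ?fine_ge0.
have := key _ growthp; have := key _ growthn; lra.
Qed.

Lemma tvrad_balayage_le : exists2 C : R, 0 <= C & forall r : R, 0 < r ->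
  (tvrad bal r <= (C * (r `^ p + r `^ (kap * q%:R) * `|bl r|))%:E)%E.
Proof.
have c0 := cut_gt0 ab.
have [Cp Cp0 HCp] := growth_integral_tail A0 p0 growthp pq.
have [Cn Cn0 HCn] := growth_integral_tail A0 p0 growthn pq.
have [Cm Cm0 HCm] := sum_nu_int_near_bound (leqnn q).
pose C1 := 2 * A * cut `^ p + 4 * (Cp + Cn) * cut `^ (p - kap * q.+1%:R) + 2 * A.
have C10 : 0 <= C1 by rewrite !addr_ge0 ?mulr_ge0 ?addr_ge0 ?powR_ge0.
exists (C1 + Cm) => [|r r_gt0]; first by rewrite addr_ge0.
apply: ge_ereal_sup => _ [n [F [HF [tF ->]]]]; rewrite lee_fin.
have mD := measurable_angle hb.
(* [T1] and [T3] separate the two variations, whereas [T2] keeps their difference inside the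
   absolute value so that the Blaschke integral can appear. *)
pose T1 : R := \sum_(i < n) (`|Rintegral mup (near r) (fun z => poisson_charge a b z (F i))| +
   `|Rintegral mun (near r) (fun z => poisson_charge a b z (F i))|).
pose T2 : R := \sum_(i < n) \sum_(1 <= k < q.+1)
  `|nu_int mup mun (near r) (e (kap * k%:R))| * `|moment a b k.-1 (F i)|.
pose T3 : R := \sum_(i < n) (`|Rintegral mup (far r) (fun z => Omega a b q z (F i))| +
   `|Rintegral mun (far r) (fun z => Omega a b q z (F i))|).
pose T4 : R := \sum_(i < n) `|chg mup mun (F i `\` D)|.
apply: (@le_trans _ _ (T1 + T2 + T3 + T4)).
  rewrite -!big_split /=; apply: ler_sum => i _; rewrite /balayage.
  rewrite (nu_int_Omega_split r_gt0 HF tF (ltn_ord i)).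
  apply: le_trans (ler_normD _ _) _; rewrite lerD2r.
  apply: le_trans (ler_normD _ _) _; apply: lerD; last exact: ler_normB.
  apply: le_trans (ler_normD _ _) _; apply: lerD; first exact: ler_normB.
  apply: le_trans (ler_norm_sum _ _ _) _; apply: ler_sum => k _.
  rewrite normrM ler_wpM2l// normrM ler_piMl// ger0_norm ?invr_ge0 ?pi_ge0//.
  by rewrite invf_le1 ?pi_gt0// (le_trans _ (pi_ge2 R))// ler1n.
have X0 : 0 <= r `^ (kap * q%:R) * `|bl r| by rewrite mulr_ge0 ?powR_ge0.
have B1 : T1 <= 2 * A * cut `^ p * r `^ p.
  have := sum_near_poisson r0 ab hb growthp r_gt0 HF tF.
  have := sum_near_poisson r0 ab hb growthn r_gt0 HF tF.
  rewrite /T1 big_split /= powRM ?(ltW r_gt0) ?(ltW c0)//.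
  set x := \sum_(i < n) _; set y := \sum_(i < n) _; lra.
have B2 : T2 <= Cm * (r `^ p + r `^ (kap * q%:R) * `|bl r|).
  apply: le_trans (HCm r r_gt0); rewrite /T2 exchange_big /= big_nat_cond [leRHS]big_nat_cond.
  apply: ler_sum => k /andP[/andP[k1 _] _]; rewrite -mulr_sumr ler_wpM2l//.
  by have := sum_moment ab r_gt0 HF tF k.-1; rewrite (prednK k1).
have B3 : T3 <= 4 * (Cp + Cn) * cut `^ (p - kap * q.+1%:R) * r `^ p.
  have := sum_far_Omega ab hb p0 r00 A0 pq nullp growthp r_gt0 HF tF HCp.
  have := sum_far_Omega ab hb p0 r00 A0 pq nulln growthn r_gt0 HF tF HCn.
  rewrite /T3 big_split /=.
  set x := \sum_(i < n) _; set y := \sum_(i < n) _; lra.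
have B4 : T4 <= 2 * A * r `^ p.
  exact: (sum_chg_le r_gt0 (measurableC mD) HF tF).
have B5 : C1 * r `^ p <= C1 * (r `^ p + r `^ (kap * q%:R) * `|bl r|).
  by rewrite ler_wpM2l// lerDl.
apply: le_trans (lerD (lerD (lerD B1 B2) B3) B4) _.
set Y := _ + _ * `|bl r| in B2 B5 *.
rewrite [leRHS]mulrDl; apply: le_trans (lerD B5 (lexx (Cm * Y))).
by rewrite le_eqVlt; apply/orP; left; apply/eqP; rewrite /C1; ring.
Qed.

Lemma blaschke_le (c : R) (r : R) :
  (\int[mup]_(z in odisc r) (modz z `^ (- (kap * q%:R)))%:E <= c%:E)%E ->
  (\int[mun]_(z in odisc r) (modz z `^ (- (kap * q%:R)))%:E <= c%:E)%E ->
  `|bl r| <= 2 * c.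
Proof.
move=> hp hn.
have mN : measurable ((odisc r `\` odisc r0) `&` D : set (pt R)).
  apply: measurableI; last exact: measurable_angle.
  by apply: measurableD; exact: measurable_odisc.
have ND : (odisc r `\` odisc r0) `&` D `<=` D by move=> z [].
have NS : (odisc r `\` odisc r0) `&` D `<=` odisc r by move=> z [[]].
have Bp := norm_Rintegral_rotpowV_le hb mN (measurable_odisc r) ND NS hp.
have Bn := norm_Rintegral_rotpowV_le hb mN (measurable_odisc r) ND NS hn.
rewrite /blaschke_int /nu_int; apply: le_trans (ler_normB _ _) _; lra.
Qed.

Lemma blaschke_subcritical : kap * q%:R < p -> exists C : R, forall r : R, 0 < r ->
  r `^ (kap * q%:R) * `|bl r| <= C * r `^ p.
Proof.
move=> kp; have kk0 : 0 <= kap * q%:R by rewrite mulr_ge0// ltW// kap_gt0.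
have [Cp Cp0 HCp] := growth_integral_head A0 r00 nullp growthp kk0 kp.
have [Cn Cn0 HCn] := growth_integral_head A0 r00 nulln growthn kk0 kp.
exists (2 * (Cp + Cn)) => r r_gt0.
have y0 : 0 <= r `^ (p - kap * q%:R) by exact: powR_ge0.
have h : `|bl r| <= 2 * ((Cp + Cn) * r `^ (p - kap * q%:R)).
  apply: blaschke_le; [apply: le_trans (HCp r r_gt0) _|apply: le_trans (HCn r r_gt0) _];
    by rewrite lee_fin ler_wpM2r// ?lerDl ?lerDr.
have -> : r `^ p = r `^ (kap * q%:R) * r `^ (p - kap * q%:R).
  by rewrite powR_pos_add// addrC subrK.
apply: le_trans (ler_wpM2l _ h) _; first exact: powR_ge0.
by rewrite le_eqVlt; apply/orP; left; apply/eqP; ring.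
Qed.

Lemma blaschke_critical : kap * q%:R = p -> exists2 C : R, 0 <= C &
  forall r : R, r0 <= r -> `|bl r| <= C * (ln r - ln r0 + 1).
Proof.
move=> kp.
have [Cp Cp0 HCp] := growth_integral_log A0 p0 r00 nullp growthp.
have [Cn Cn0 HCn] := growth_integral_log A0 p0 r00 nulln growthn.
exists (2 * (Cp + Cn)) => [|r rr]; first by rewrite mulr_ge0// addr_ge0.
have l0 : ln r0 <= ln r by rewrite ler_ln ?posrE// (lt_le_trans r00).
rewrite -[leRHS]mulrA; apply: blaschke_le; rewrite kp.
  by apply: le_trans (HCp r rr) _; rewrite lee_fin ler_wpM2r ?lerDl//; lra.
by apply: le_trans (HCn r rr) _; rewrite lee_fin ler_wpM2r ?lerDr//; lra.
Qed.

End Balayage.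

(** * Monotonicity in the radius and the limit at radius zero *)

Section TotalVariation.
Variable R : realType.

Lemma le_tvrad (m : set (pt R) -> R) (r s : R) : r <= s -> (tvrad m r <= tvrad m s)%E.
Proof.
move=> rs; apply: le_ereal_sup => _ [n [F [HF [tF ->]]]].
exists n, F; split=> // i /HF[mF Fr]; split=> // z /Fr /= zr; exact: le_trans rs.
Qed.

Lemma blaschke_int_inner (a b s r0 r : R) (mup mun : {measure set (pt R) -> \bar R}) :
  r <= r0 -> blaschke_int a b s r0 mup mun r = 0.
Proof.
move=> rr0; rewrite /blaschke_int (_ : _ `&` _ = set0).
  by rewrite /nu_int !Rintegral_set0 subr0.
by apply/seteqP; split=> // z [[/= zr]] []; exact: lt_le_trans rr0.
Qed.

(** For [p = 0] the value [0^0 = 1] leaves room, and monotonicity suffices. For [p > 0] the right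
    side is 0, and the bound follows by letting positive radii shrink. *)
Lemma tvrad_at_zero (m : set (pt R) -> R) (C p r0 : R) : 0 <= C -> 0 <= p -> 0 < r0 ->
  (forall r, 0 < r -> r <= r0 -> (tvrad m r <= (C * r `^ p)%:E)%E) ->
  (tvrad m 0 <= (C * 0 `^ p)%:E)%E.
Proof.
move=> C0; rewrite le_eqVlt => /orP[/eqP <-|p0] r00 H.
  by apply: le_trans (le_tvrad m (ltW r00)) _; apply: le_trans (H r0 r00 _) _ => //; rewrite !powRr0.
rewrite powR0 ?gt_eqF// mulr0; apply/lee_addgt0Pr => eps e0; rewrite add0e.
have C1 : 0 < C + 1 by rewrite ltr_wpDl.
(* Chosen so that [C * r^p <= C * eps / (C + 1) <= eps]; the [+ 1] avoids division by zero when
   [C = 0]. *)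
pose r := Num.min r0 ((eps / (C + 1)) `^ p^-1).
have r_gt0 : 0 < r by rewrite lt_min r00 powR_gt0// divr_gt0.
apply: le_trans (le_tvrad m (ltW r_gt0)) _.
apply: le_trans (H r r_gt0 _) _; first by rewrite ge_min lexx.
rewrite lee_fin.
have rp : r `^ p <= eps / (C + 1).
  apply: (@le_trans _ _ (((eps / (C + 1)) `^ p^-1) `^ p)).
    rewrite ge0_ler_powR ?nnegrE ?powR_ge0 ?(ltW p0) ?(ltW r_gt0)//.
    by rewrite ge_min lexx orbT.
  by rewrite -powRrM mulVf ?gt_eqF// powRr1// divr_ge0// ltW.
apply: le_trans (ler_wpM2l C0 rp) _.
rewrite mulrA ler_pdivrMr// mulrC ler_pM2l//; lra.
Qed.

End TotalVariation.

Theorem theorem5 (R : realType) (a b p r0 : R) (q : nat)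
  (mup mun : {measure set (pt R) -> \bar R}) :
  a < b -> b <= a + 2 * pi -> 0 <= p ->
  jordan mup mun ->
  finite_type (chg mup mun) p ->
  (q : int) = Num.floor ((b - a) / pi * p) ->
  0 < r0 -> odisc r0 `&` csupport (chg mup mun) = set0 ->
  [/\ (balayage_exists a b q mup mun /\
       exists C : R, forall r : R, 0 <= r ->
         (tvrad (balayage a b q mup mun) r <=
          (C * (r `^ p + r `^ (pi * q%:R / (b - a)) *
                `|blaschke_int a b (pi * q%:R / (b - a)) r0 mup mun r|))%:E)%E),
      (exists C r1 : R, forall r : R, r1 <= r ->
         (tvrad (balayage a b q mup mun) r <= (C * (r `^ p * ln r))%:E)%E),
      (~ (exists n : nat, (b - a) / pi * p = n%:R)) ->
         finite_type (balayage a b q mup mun) p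
    & ((b - a) / pi * p = q%:R) ->
      (exists M r1 : R, forall r : R, r1 <= r ->
         `|blaschke_int a b p r0 mup mun r| <= M) ->
         finite_type (balayage a b q mup mun) p].
Proof.
move=> ab hb p0 Hj Hft qE r00 Hsupp.
have ba0 : 0 < b - a by rewrite subr_gt0.
rewrite (_ : pi * q%:R / (b - a) = pi / (b - a) * q%:R); last by rewrite mulrAC.
set kap := pi / (b - a).
have k0 : 0 < kap := kap_gt0 ab.
set x := (b - a) / pi * p in qE *.
(* Multiplied by [kap], the inequalities [q <= x < q + 1] of the floor become the two conditions on
   exponents behind all estimates. *)
have xE : kap * x = p.
  by rewrite /kap /x mulrA mulrA divfK ?divff ?mul1r// gt_eqF// pi_gt0.
have qx : q%:R <= x by have := floor_le x; rewrite -qE.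
have xq : x < q.+1%:R by have := floorD1_gt x; rewrite -qE -[(q%:Z + 1)%R]/((q + 1)%N%:Z) addn1.
have qp : kap * q%:R <= p by rewrite -xE ler_pM2l.
have pq : p < kap * q.+1%:R by rewrite -xE ltr_pM2l.
have [nullp nulln] := jordan_inner_null Hj Hsupp.
have [A A0 HA] := jordan_growth Hj p0 r00 Hft Hsupp.
have gp r r_gt0 := (HA r r_gt0).1.
have gn r r_gt0 := (HA r r_gt0).2.
have [C C0 HC] := tvrad_balayage_le ab hb p0 r00 A0 nullp nulln gp gn qp pq.
have sub : kap * q%:R < p -> exists C' : R, forall r, 0 < r ->
    (tvrad (balayage a b q mup mun) r <= (C' * r `^ p)%:E)%E.
  move=> kp; have [C' HC'] := blaschke_subcritical ab hb r00 A0 nullp nulln gp gn kp.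
  exists (C * (1 + C')) => r r_gt0; apply: le_trans (HC r r_gt0) _.
  rewrite lee_fin -[leRHS]mulrA ler_wpM2l// [leRHS]mulrDl mul1r lerD2l; exact: HC'.
split.
- split; first exact: (balayage_exists_of_growth ab hb p0 r00 A0 Hj nullp nulln gp gn pq).
  exists C => r; rewrite le_eqVlt => /orP[/eqP <-|]; last exact: HC.
  (* At [r = 0], and at all radii up to [r0], the Blaschke domain is empty, so the pure power bound
     is available for the limit. *)
  rewrite blaschke_int_inner ?(ltW r00)// normr0 mulr0 addr0.
  apply: (tvrad_at_zero C0 p0 r00) => s s0 sr; apply: le_trans (HC s s0) _.
  by rewrite blaschke_int_inner// normr0 mulr0 addr0.
(* From radius [e] on the logarithm is at least 1 and absorbs constants. *)
- have e1 (r : R) : expR 1 <= r -> 1 <= ln r.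
    by move=> er; rewrite -[leLHS]expRK ler_ln ?posrE ?expR_gt0// (lt_le_trans (expR_gt0 1)).
  move: qp; rewrite le_eqVlt => /orP[/eqP kp|/sub[C' HC']].
    have [C' C'0 HC'] := blaschke_critical hb p0 r00 A0 nullp nulln gp gn kp.
    (* Obtained from [ln r - ln r0 + 1 <= (2 + |ln r0|) * ln r] and [1 <= ln r]. *)
    exists (C * (1 + C' * (2 + `|ln r0|))), (Num.max r0 (expR 1)) => r.
    rewrite ge_max => /andP[rr er]; have r_gt0 := lt_le_trans r00 rr.
    have l1 := e1 r er; apply: le_trans (HC r r_gt0) _.
    move: (HC' r rr); rewrite -/kap kp => hbl.
    rewrite lee_fin -[leRHS]mulrA ler_wpM2l// [leRHS]mulrCA.
    rewrite -[X in X + _]mulr1 -mulrDr ler_wpM2l ?powR_ge0//.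
    rewrite [leRHS]mulrDl mul1r lerD//; apply: le_trans hbl _.
    rewrite -[leRHS]mulrA ler_wpM2l//.
    have := ler_norm (- ln r0); rewrite normrN => h.
    have h2 : `|ln r0| <= `|ln r0| * ln r by rewrite ler_peMr.
    lra.
  exists `|C'|, (expR 1) => r er; have l1 := e1 r er.
  have r_gt0 : 0 < r := lt_le_trans (expR_gt0 1) er.
  apply: le_trans (HC' r r_gt0) _; rewrite lee_fin mulrA.
  apply: le_trans (_ : `|C'| * r `^ p <= _).
    by rewrite ler_wpM2r ?powR_ge0// ler_norm.
  by rewrite ler_peMr// mulr_ge0 ?powR_ge0.
(* If [kap * q] were equal to [p], then [x] would be the natural number [q]; so the subcritical
   bound applies. *)
- move=> nx; have /sub[C' HC'] : kap * q%:R < p.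
    rewrite lt_neqAle qp andbT; apply/eqP => kp; apply: nx; exists q.
    by apply: (mulfI (lt0r_neq0 k0)); rewrite xE kp.
  by exists C', 1 => r r1; apply: HC'; exact: lt_le_trans r1.
(* Here [kap * q = p], so the Blaschke integral of the hypothesis is the one in the general
   bound. *)
- move=> xq' [M [r1 HM]]; have kp : kap * q%:R = p by rewrite -xq' xE.
  exists (C * (1 + M)), (Num.max 1 r1) => r; rewrite ge_max => /andP[r1' rr].
  have r_gt0 : 0 < r := lt_le_trans ltr01 r1'.
  apply: le_trans (HC r r_gt0) _; rewrite lee_fin kp -[leRHS]mulrA ler_wpM2l//.
  rewrite [leRHS]mulrDl mul1r lerD2l mulrC ler_wpM2r ?powR_ge0//.
  exact: HM.
Qed.
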